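(* Let $(\mathfrak{X},+,\mathcal{A})$ be a measurable Abelian group, $n\in\mathbb{N}$, let $F_1,\dots,F_n,G\in\mathcal{F}$ be probability distributions on $(\mathfrak{X},\mathcal{A})$, and set $F_0=\overline{F}=\frac{1}{n}\sum_{j=1}^nF_j$. Put \[V_k=\sum_{J\subseteq\{1,\dots,n\}:\;|J|=k}\ \prod_{j\in J}(F_j-G)\quad(k\in\{0,\dots,n\}),\qquad W_\ell=\sum_{k=0}^\ell V_k\,G^{n-k}\quad(\ell\in\{0,\dots,n\}).\] For $j,k\in\{1,\dots,n\}$ and $m\in\mathbb{N}$ set \[M_{j,k}=(F_j-G)\,G^{\lfloor (n-k)/k\rfloor},\qquad \nu_{k,m}=\sum_{j=1}^n\|M_{j,k}\|^m,\qquad \widetilde{\nu}_k=\Big\|\sum_{j=1}^nM_{j,k}\Big\|.\] For $\ell\in\{0,\dots,n\}$ and $\alpha\in[0,\infty)$ set \[\eta_{\ell,\alpha}=\max_{k\in\{\ell+1,\dots,n\}}\Big[\frac{1}{k^{1+\alpha}}\Big(\frac{\widetilde{\nu}_k^2}{4c_1}+\nu_{k,2}\Big)\Big],\qquad \eta_\ell=\eta_{\ell,0},\] where \[c_1=\sup_{x\in(0,\infty)}\Big[\frac{\ln(2-(1-x)e^x)}{x^2}\Big]=0.694025\ldots.\] (a) Let $\alpha\in[0,\infty)$, $\ell\in\{0,\dots,n\}$, and $\beta=\lceil\alpha(\ell+1)/2\rceil$. If $\eta_\ell<(2e\,c_1)^{-1}$, then \[\Big\|\prod_{j=1}^nF_j-W_\ell\Big\|\leq(\ell+1)^{\beta}\,\beta!\,\frac{(2e\,c_1\,\eta_{\ell,\alpha})^{(\ell+1)/2}}{(1-\sqrt{2e\,c_1\,\eta_\ell})^{\beta+1}}.\]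 In particular, for $\alpha=0$, \[\Big\|\prod_{j=1}^nF_j-W_\ell\Big\|\leq\frac{(2e\,c_1\,\eta_\ell)^{(\ell+1)/2}}{1-\sqrt{2e\,c_1\,\eta_\ell}}.\] (b) Assume that for each $j\in\{0,\dots,n\}$ there exists $B_j\in\mathcal{A}$ such that the restriction $F_j|_{B_j^{\mathrm c}}$ is absolutely continuous with respect to $G$, and let $f_j$ denote a Radon–Nikodym density of $F_j|_{B_j^{\mathrm c}}$ with respect to $G$. Then, for $\ell\in\{0,\dots,n\}$, \begin{align*} \eta_\ell\leq{}&\frac{1}{4c_1}\Big[\frac{n}{\sqrt{\ell+1}}\Big(\big\|(\overline{F}-G)|_{B_0}\big\|+\big|(\overline{F}-G)(B_0)\big|\Big)+\sqrt{2n}\Big(\int_{B_0^{\mathrm c}}(f_0-1)^2\,dG\Big)^{1/2}\Big]^2\\ &+\sum_{j=1}^n\Big[\frac{1}{\sqrt{\ell+1}}\Big(\big\|(F_j-G)|_{B_j}\big\|+\big|(F_j-G)(B_j)\big|\Big)+\sqrt{\frac{2}{n}}\Big(\int_{B_j^{\mathrm c}}(f_j-1)^2\,dG\Big)^{1/2}\Big]^2. \end{align*}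
   Context: A measurable Abelian group $(\mathfrak{X},+,\mathcal{A})$ is a commutative group $(\mathfrak{X},+)$ with identity $0$ together with a $\sigma$-algebra $\mathcal{A}$ on $\mathfrak{X}$ such that $(x,y)\mapsto x-y$ is measurable from $(\mathfrak{X}\times\mathfrak{X},\mathcal{A}\otimes\mathcal{A})$ to $(\mathfrak{X},\mathcal{A})$. $\mathcal{F}$ is the set of probability distributions and $\mathcal{M}$ the set of finite signed measures on $(\mathfrak{X},\mathcal{A})$. Products and powers of elements of $\mathcal{M}$ are convolutions: $VW(A)=\int_{\mathfrak{X}}V(A-x)\,dW(x)$; empty products and zeroth powers equal $I=I_0$, where $I_x$ is the Dirac measure at $x$. $\|V\|=(V^++V^-)(\mathfrak{X})$ is the total variation norm, where $V=V^+-V^-$ is the Hahn–Jordan decomposition. The restriction $V|_B$ of a signed measure is $V|_B(A)=V(A\cap B)$; $B^{\mathrm c}$ is the complement of $B$. $\lfloor\cdot\rfloor$ and $\lceil\cdot\rceil$ are floor and ceiling. A maximum over the empty set (case $\ell=n$) is read as $0$. Integrals of non-negative functions may take the value $+\infty$. *)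

(* Defs.v *)
From HB Require Import structures.
From mathcomp Require Import all_boot all_order all_algebra.
From mathcomp Require Import all_classical all_reals all_analysis.

Set Implicit Arguments.
Unset Strict Implicit.
Unset Printing Implicit Defensive.

Import Order.TTheory GRing.Theory Num.Theory.
Import numFieldNormedType.Exports.

Local Open Scope classical_set_scope.
Local Open Scope ring_scope.

(* This structure carries its own group operations because no structure below
   Measurable and GRing.Zmodule (e.g. joining Pointed and GRing.Zmodule) can be
   declared once normed modules are loaded. The operations are those of the
   GRing.Zmodule instance declared next, so the usual additive notations and
   lemmas apply to [T : measurableZmodType d]. *)
HB.mixin Record Measurable_isMeasurableZmodule (d : measure_display) T
    of Measurable d T := {
  mzero : T;
  mopp : T -> T;
  madd : T -> T -> T;
  maddA : associative madd;
  maddC : commutative madd;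
  madd0 : left_id mzero madd;
  maddN : left_inverse mzero mopp madd;
  measurable_msub :
    measurable_fun [set: T * T] (fun p : T * T => madd p.1 (mopp p.2)) }.

#[short(type=measurableZmodType)]
HB.structure Definition MeasurableZmodule d :=
  {T of Measurable d T & Measurable_isMeasurableZmodule d T}.

#[non_forgetful_inheritance]
HB.instance Definition _ d (T : measurableZmodType d) :=
  GRing.isZmodule.Build (MeasurableZmodule.sort T)
    (@maddA d T) (@maddC d T) (@madd0 d T) (@maddN d T).

Lemma measurable_subr d (T : measurableZmodType d) :
  measurable_fun [set: T * T] (fun p : T * T => p.1 - p.2 : T).
Proof. exact: measurable_msub. Qed.

Section jordan.
Context d (T : measurableType d) (R : realType).
Variable V : {charge set T -> \bar R}.

(* A chosen Hahn decomposition. The values on measurable sets of the Jordan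
   parts and of the variation do not depend on the choice. *)
Definition hahn_pair :
  {PN : set T * set T | hahn_decomposition V PN.1 PN.2}.
Proof.
by apply: cid; have [P [N PN]] := Hahn_decomposition V; exists (P, N).
Qed.

Definition charge_pos : {finite_measure set T -> \bar R} :=
  jordan_pos (svalP hahn_pair).

Definition charge_neg : {finite_measure set T -> \bar R} :=
  jordan_neg (svalP hahn_pair).

Definition tvnorm : R := fine (charge_variation (svalP hahn_pair) setT).

Definition charge_integral (f : T -> \bar R) : \bar R :=
  (\int[charge_pos]_x f x - \int[charge_neg]_x f x)%E.

Lemma charge_pos_negE A : measurable A ->
  V A = (charge_pos A - charge_neg A)%E.
Proof.
by move=> mA; rewrite (jordan_decomp (svalP hahn_pair) mA) /cadd/= cscaleN1.
Qed.

End jordan.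

Section measurable_group.
Context d (T : measurableZmodType d).

Definition subset_sub (A : set T) (x : T) : set T := [set a - x | a in A].

Lemma subset_subE A x : subset_sub A x = [set y | A (y + x)].
Proof.
apply/seteqP; split=> [y [a Aa <-]|y Ay]/=; first by rewrite subrK.
by exists (y + x) => //; rewrite addrK.
Qed.

Definition addp (p : T * T) : T := p.2 + p.1.

Lemma measurable_addp : measurable_fun setT addp.
Proof.
have mN : measurable_fun setT (fun p : T * T => 0 - p.1 : T).
  have -> : (fun p : T * T => 0 - p.1 : T) =
    (fun q : T * T => q.1 - q.2) \o (fun p : T * T => (0, p.1)) by [].
  apply: measurableT_comp; first exact: measurable_subr.
  by apply: measurable_fun_pair => //; exact: measurable_fst.
have -> : addp =
    (fun q : T * T => q.1 - q.2) \o (fun p : T * T => (p.2, 0 - p.1)).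
  by apply/funext => p /=; rewrite /addp sub0r opprK.
apply: measurableT_comp; first exact: measurable_subr.
by apply: measurable_fun_pair => //; exact: measurable_snd.
Qed.

Lemma measurable_addpV (A : set T) : measurable A ->
  measurable (addp @^-1` A).
Proof. by move=> mA; rewrite -[X in measurable X]setTI; exact: measurable_addp. Qed.

Lemma xsection_addp (A : set T) x :
  xsection (addp @^-1` A) x = subset_sub A x.
Proof.
by rewrite subset_subE; apply/seteqP; split => y; rewrite /xsection/= inE.
Qed.

Lemma measurable_subset_sub (A : set T) x : measurable A ->
  measurable (subset_sub A x).
Proof.
by move=> mA; rewrite -xsection_addp; apply: measurable_xsection;
  exact: measurable_addpV.
Qed.

End measurable_group.

Section finite_measure_convolution.
Context d (T : measurableZmodType d) (R : realType).
Variables m1 m2 : {finite_measure set T -> \bar R}.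
Local Open Scope ereal_scope.

Definition mconv (A : set T) : \bar R := \int[m1]_x m2 (subset_sub A x).

Lemma mconvE : mconv = fun A => (m1 \x m2) (@addp d T @^-1` A).
Proof.
by apply/funext => A; apply: eq_integral => x _ /=; rewrite xsection_addp.
Qed.

Lemma integrable_subset_sub A : measurable A ->
  m1.-integrable setT (fun x => m2 (subset_sub A x)).
Proof.
move=> mA; apply: (@le_integrable _ _ _ m1 _ measurableT _ (cst (m2 setT))).
- under eq_fun do rewrite -xsection_addp.
  exact: measurable_fun_xsection (measurable_addpV mA).
- move=> x _ /=; rewrite !gee0_abs//.
  by apply: le_measure => //; rewrite inE//; exact: measurable_subset_sub.
- apply/integrableP; split; first exact: measurable_cst.
  rewrite /= integral_cst//.
  by rewrite -ge0_fin_numE ?mule_ge0// fin_numM// ?abse_fin_num fin_num_measure.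
Qed.

Let mconv0 : mconv set0 = 0.
Proof. by rewrite mconvE preimage_set0 measure0. Qed.

Let mconv_fin A : measurable A -> mconv A \is a fin_num.
Proof.
by move=> mA; apply: integrable_fin_num => //; exact: integrable_subset_sub.
Qed.

Let mconv_sigma_additive : semi_sigma_additive mconv.
Proof.
rewrite mconvE => A mA tA mUA /=; rewrite preimage_bigcup.
apply: measure_semi_sigma_additive.
- by move=> n; exact: measurable_addpV.
- apply/trivIsetP => i j _ _ ij; rewrite -preimage_setI.
  by move/trivIsetP : tA => /(_ _ _ Logic.I Logic.I ij) ->; rewrite preimage_set0.
- by rewrite -preimage_bigcup; exact: measurable_addpV.
Qed.

HB.instance Definition _ := isCharge.Build _ _ _ mconv
  mconv0 mconv_fin mconv_sigma_additive.

End finite_measure_convolution.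

Section convolution.
Context d (T : measurableZmodType d) (R : realType).
Variables V W : {charge set T -> \bar R}.
Local Open Scope ereal_scope.

Definition cconv (A : set T) : \bar R :=
  charge_integral W (fun x => V (subset_sub A x)).

Let cconv_mconv : {charge set T -> \bar R} :=
  cadd (cadd (mconv (charge_pos W) (charge_pos V))
             (copp (mconv (charge_pos W) (charge_neg V))))
       (copp (cadd (mconv (charge_neg W) (charge_pos V))
                   (copp (mconv (charge_neg W) (charge_neg V))))).

Lemma cconvE A : measurable A -> cconv A =
  (mconv (charge_pos W) (charge_pos V) A -
     mconv (charge_pos W) (charge_neg V) A) -
  (mconv (charge_neg W) (charge_pos V) A -
     mconv (charge_neg W) (charge_neg V) A).
Proof.
move=> mA; rewrite /cconv /charge_integral /mconv.
have VE x : V (subset_sub A x) =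
    charge_pos V (subset_sub A x) - charge_neg V (subset_sub A x).
  by rewrite -charge_pos_negE//; exact: measurable_subset_sub.
under eq_integral do rewrite VE.
under [X in _ - X]eq_integral do rewrite VE.
by rewrite !integralB//; exact: integrable_subset_sub.
Qed.

Let cconv_mconvE A : measurable A -> cconv A = cconv_mconv A.
Proof. by move=> mA; rewrite cconvE. Qed.

Let cconv0 : cconv set0 = 0.
Proof. by rewrite cconv_mconvE// charge0. Qed.

Let cconv_fin A : measurable A -> cconv A \is a fin_num.
Proof. by move=> mA; rewrite cconv_mconvE// fin_num_measure. Qed.

Let cconv_sigma_additive : semi_sigma_additive cconv.
Proof.
move=> A mA tA mUA; rewrite cconv_mconvE//.
under eq_fun do under eq_bigr do rewrite cconv_mconvE//.
exact: charge_semi_sigma_additive.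
Qed.

HB.instance Definition _ := isCharge.Build _ _ _ cconv
  cconv0 cconv_fin cconv_sigma_additive.

End convolution.

(* Convolution identities (associativity, unit, ...) hold on measurable sets
   only: the values of a charge on nonmeasurable sets are unconstrained. *)
Section signed_measures.
Context d (T : measurableZmodType d) (R : realType).
Local Notation M := (charge T R).

Definition saddm (V W : M) : M := cadd V W.
Definition ssubm (V W : M) : M := cadd V (copp W).
Definition szero : M := czero.
Definition sconv (V W : M) : M := cconv V W.
Definition sdirac0 : M := charge_of_finite_measure (@dirac d T 0 R).
Definition sconv_exp (V : M) (k : nat) : M := iter k (sconv V) sdirac0.
Definition scharge (P : probability T R) : M := charge_of_finite_measure P.

End signed_measures.

(* Real-valued version of the conclusion of [Radon_Nikodym0]; the density is
   only determined up to a null set, so [f] is an arbitrary version. *)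
Definition is_density d (T : measurableType d) (R : realType)
    (nu : {charge set T -> \bar R}) (mu : {measure set T -> \bar R})
    (f : T -> R) :=
  mu.-integrable setT (EFin \o f) /\
  forall A, measurable A -> nu A = (\int[mu]_(x in A) (f x)%:E)%E.

(* The set has a finite supremum, so that [sup] is not its default value. *)
Definition c1 (R : realType) : R :=
  sup [set ln (2 - (1 - x) * expR x) / x ^+ 2 | x in [set x : R | 0 < x]].

Section approximation.
Context d (T : measurableZmodType d) (R : realType) (n : nat).
Variables (F : 'I_n -> probability T R) (G : probability T R).
Local Notation M := (charge T R).

Definition Fdiff (j : 'I_n) : M := ssubm (scharge (F j)) (scharge G).

Definition Fmean : M :=
  cscale n%:R^-1 (\big[@saddm d T R/szero T R]_(j < n) scharge (F j)).

Definition Fprod : M := \big[@sconv d T R/sdirac0 T R]_(j < n) scharge (F j).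

Definition Vk (k : nat) : M :=
  \big[@saddm d T R/szero T R]_(J : {set 'I_n} | #|J| == k)
    \big[@sconv d T R/sdirac0 T R]_(j in J) Fdiff j.

Definition Wl (l : nat) : M :=
  \big[@saddm d T R/szero T R]_(0 <= k < l.+1)
    sconv (Vk k) (sconv_exp (scharge G) (n - k)).

Definition Mjk (j : 'I_n) (k : nat) : M :=
  sconv (Fdiff j) (sconv_exp (scharge G) ((n - k) %/ k)).

Definition nu_ (k m : nat) : R := \sum_(j < n) tvnorm (Mjk j k) ^+ m.

Definition nu_tilde (k : nat) : R :=
  tvnorm (\big[@saddm d T R/szero T R]_(j < n) Mjk j k).

(* The terms are nonnegative, hence the default value 0 only matters for the
   empty range [l = n]. *)
Definition eta (l : nat) (alpha : R) : R :=
  \big[Num.max/0]_(l.+1 <= k < n.+1)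
    ((k%:R `^ (1 + alpha))^-1 *
     (nu_tilde k ^+ 2 / (4 * c1 R) + nu_ k 2)).

End approximation.

(* Main.v *)
From HB Require Import structures.
Require Import Defs.
From mathcomp Require Import all_boot all_order all_algebra.
From mathcomp Require Import all_classical all_reals all_analysis.
From mathcomp Require Import measurable_realfun zify ring lra.

(** Finite signed measures, identified when they agree on measurable sets, form
    a commutative algebra under convolution, and the total variation is a
    submultiplicative norm on it that is at most 1 on probabilities. Write [g]
    for [G], [f_j] for [F_j], and [e_k] for the k-th elementary symmetric
    function. Expanding the product of the [g + (f_j - g)] gives
    [prod_j f_j = sum_k e_k(f - g) g^(n-k)], of which [W_l] is the sum over
    [k <= l]. Since [k floor((n-k)/k) <= n - k], the k-th summand is
    [e_k(M_1, ..., M_n)] times a power of [g], with [M_j = (f_j - g) g^q] and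
    [q = floor((n-k)/k)], so for part (a) it remains to bound the [e_k] of
    arbitrary elements [M_j] by [nu~ = ||sum_j M_j||] and
    [nu2 = sum_j ||M_j||^2].

    Now [e_k] is the coefficient of [z^k] in
    [prod_j (1 + z M_j) = exp(z sum_j M_j) prod_j (1 + z M_j) exp(-z M_j)].
    The coefficients of [(1 + x) exp(-x)] have the same absolute values as
    those of [2 - (1 - x) exp(x)], which at [x >= 0] is at most [exp(c1 x^2)] by
    the definition of [c1]. The other factor has the coefficients
    [(sum_j M_j)^m / m!]; the inequality [x^m / m! <= exp(x^2 / 4)] makes its
    contribution quadratic in the radius as well. Hence
    [||e_k|| r^k <= exp(r^2 (nu~^2 / 4 + c1 nu2))] for all [r >= 0]
    ([seminorm_elem_sym_le]), and the best [r] gives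
    [||e_k|| <= (2 e c1 Y_k / k)^(k/2)] with [Y_k = nu~^2 / (4 c1) + nu2].
    Of the exponent [k / 2], the part [(l+1) / 2] is estimated through
    [eta_(l,alpha)] and the rest through [eta_l]; the sum over [k > l] is then
    dominated by a binomial series ([seminorm_prod_sub_le]).

    For part (b), split [F_j - G] into its restrictions to [B_j] and to the
    complement of [B_j]. The first one is only estimated by its norm. The second
    one has a [G]-density [h], and what is needed is that convolution with [G^q]
    brings its norm down to the order [(int h^2 dG / (q+1))^(1/2)]
    ([tv_density_smoothing_le]). By duality the norm is a supremum of
    expectations [E h(X_1) u(S)] over measurable functions [u] with [|u| <= 1],
    where [S] is the sum of [q+1] independent variables [X_i] of law [G]. By the
    Cauchy-Schwarz inequality it suffices that the variance of
    [E(u(S) | X_1)] is at most [1 / (q+1)]: the [q+1] conditional expectations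
    [E(u(S) | X_i)] have equal variances, and these add up to at most the
    variance of [u(S)] ([variance_smoothing]). Finally
    [q + 1 = floor(n/k) >= n / (2k)].

    The decimals of [c1] come from an explicit upper bound
    [2 - (1 - x) exp(x) <= exp(C x^2)] for a rational [C] slightly above [c1]
    ([kerstan_factor_le]) and from the value at a rational point close to the
    maximizer. *)

Set Implicit Arguments.
Unset Strict Implicit.
Unset Printing Implicit Defensive.

Import Order.TTheory GRing.Theory Num.Theory.
Import numFieldNormedType.Exports.

Local Open Scope classical_set_scope.
Local Open Scope ring_scope.

(** * The constant c1 *)

Section exponential.
Variable R : realType.
Implicit Types (s t x y : R) (n k : nat).

Definition exp_partial x n : R := \sum_(i < n) x ^+ i / i`!%:R.

Lemma exp_partial_cvg x : exp_partial x @ \oo --> expR x.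
Proof.
rewrite (_ : exp_partial x = series (exp_coeff x)).
  exact: is_cvg_series_exp_coeff.
by apply/funext => n; rewrite /exp_partial /series /exp_coeff /= big_mkord.
Qed.

Lemma exp_partial_le x n : 0 <= x -> exp_partial x n <= expR x.
Proof.
move=> x0; rewrite -(cvg_lim _ (@exp_partial_cvg x))//.
apply: nondecreasing_cvgn_le; last exact: cvgP (@exp_partial_cvg x).
apply/nondecreasing_seqP => m; rewrite /exp_partial big_ord_recr/=.
by rewrite lerDl divr_ge0// exprn_ge0.
Qed.

(** The tail is termwise dominated by [x ^+ n / n`!] times the series, as
    [n`! * i`! <= (n + i)`!]. *)
Lemma exp_remainder x n : 0 <= x ->
  expR x - exp_partial x n <= x ^+ n / n`!%:R * expR x.
Proof.
move=> x0.
have cx : exp_partial x m - exp_partial x n @[m --> \oo] -->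
    expR x - exp_partial x n by apply: cvgB; [exact: exp_partial_cvg|exact: cvg_cst].
rewrite -(cvg_lim _ cx)//.
apply: limr_le; first exact: cvgP cx.
near=> m.
have -> : m = (n + (m - n))%N by rewrite subnKC//; near: m; exact: nbhs_infty_ge.
rewrite /exp_partial big_split_ord/= addrAC subrr add0r.
have : x ^+ n / n`!%:R * exp_partial x (m - n) <= x ^+ n / n`!%:R * expR x.
  by rewrite ler_wpM2l ?divr_ge0 ?exprn_ge0 ?exp_partial_le.
apply: le_trans; rewrite /exp_partial mulr_sumr ler_sum// => i _.
rewrite exprD mulrACA ler_wpM2l ?mulr_ge0 ?exprn_ge0// -invfM -natrM.
rewrite lef_pV2 ?posrE ?ltr0n ?muln_gt0 ?fact_gt0// ler_nat.
by rewrite -(@bin_fact (n + i) n) ?leq_addr// addKn leq_pmull// bin_gt0 leq_addr.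
Unshelve. all: by end_near. Qed.

(** For negative [t = - s] this follows from the upper bound that
    [exp_remainder] gives for [expR s], because the cubic Taylor polynomials at
    [s] and [- s] have the product [1 - s^4 / 12 - s^6 / 36 <= 1 - s^4 / 24]. *)
Lemma expR_ge_cubic t : 1 + t + t ^+ 2 / 2 + t ^+ 3 / 6 <= expR t.
Proof.
have [t0|t0] := leP 0 t.
  apply: le_trans (exp_partial_le 4 t0).
  by rewrite /exp_partial !big_ord_recr big_ord0/= !factS fact0 !natrM /=; lra.
have : 0 <= - t by rewrite oppr_ge0 ltW.
rewrite -{2 3 4 5}[t]opprK; move: (- t) => s s0.
have := exp_remainder 4 s0; have := expR_gt0 s.
rewrite expRN /exp_partial !big_ord_recr big_ord0/= !factS fact0 /=.
move: (expR s) => E E0 H.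
rewrite -(ler_pM2r E0) mulVf ?gt_eqF//.
set P := (X in X * E); set S := (X in E - X) in H; set q := s ^+ 4 / 24.
have S1 : 1 <= S :> R.
  rewrite /S -!addrA add0r divr1 expr0 lerDl.
  by rewrite !addr_ge0// divr_ge0// exprn_ge0.
have PS : P * S <= 1 - q.
  have := exprn_ge0 4 s0; have := exprn_ge0 6 s0.
  by rewrite /P /S /q; lra.
have Eq : (1 - q) * E <= S by move: H; rewrite /q /= -/S; lra.
have [P0|P0] := leP P 0.
  by apply: le_trans ler01; rewrite mulr_le0_ge0// ltW.
have q1 : 0 < 1 - q by apply: lt_le_trans PS; rewrite mulr_gt0//; lra.
rewrite -(ler_pM2l q1) mulr1 mulrCA; apply: le_trans PS.
by rewrite ler_pM2l.
Qed.

(** The quadratic Taylor polynomials at [s] and [- s] have the product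
    [1 + s^4 / 4 >= 1]. *)
Lemma expRN_le_quadratic s : 0 <= s -> expR (- s) <= 1 - s + s ^+ 2 / 2.
Proof.
move=> s0; have := exp_partial_le 3 s0; have := expR_gt0 s.
rewrite expRN /exp_partial !big_ord_recr big_ord0/= !factS fact0 /=.
move: (expR s) => E E0 H.
rewrite -(ler_pM2r E0) mulVf ?gt_eqF//.
have P0 : 0 <= 1 - s + s ^+ 2 / 2 by have := sqr_ge0 (s - 1); lra.
apply: le_trans (ler_wpM2l P0 H); have := exprn_ge0 4 s0; lra.
Qed.

(** Away from the maximizer of [ln (2 - (1 - x) e^x) / x^2], which is about
    0.936, the smaller constant [34 / 49] suffices, and Taylor polynomials at 0
    decide. *)
Lemma kerstan_factor_le_small x : 0 <= x <= 13 / 20 ->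
  2 - (1 - x) * expR x <= expR (34 / 49 * x ^+ 2).
Proof.
move=> /andP[x0 x1].
have y0 : 0 <= 34 / 49 * x ^+ 2 by have := sqr_ge0 x; lra.
have := exp_partial_le 5 x0; have := exp_partial_le 3 y0.
rewrite /exp_partial !big_ord_recr !big_ord0/= !factS fact0 !natrM /=.
move: (expR x) (expR _) => E E' e2 e1.
have H : 0 <= (1 - x) * (E - (1 + x + x ^+ 2 / 2 + x ^+ 3 / 6 + x ^+ 4 / 24)).
  by apply: mulr_ge0; [|rewrite subr_ge0]; lra.
suff : 0 <= x ^+ 2 * (19 / 98 - x / 3 + 23 / 200 * x ^+ 2 - x ^+ 3 / 24).
  have := exprn_ge0 4 x0; have := exprn_ge0 5 x0; lra.
apply: mulr_ge0; first exact: sqr_ge0.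
clear e1 e2 H.
have h2 := sqr_ge0 (x - 13 / 20).
have h3 : 0 <= x * (13 / 20 - x) * (13 / 20 + x).
  by apply: mulr_ge0; [apply: mulr_ge0|]; lra.
lra.
Qed.

(** The nested form keeps the literals small and makes evaluation at rational
    points cheap. *)
Lemma exp_partial10E y : exp_partial y 10 =
  1 + y * (1 + y / 2 * (1 + y / 3 * (1 + y / 4 * (1 + y / 5 *
    (1 + y / 6 * (1 + y / 7 * (1 + y / 8 * (1 + y / 9)))))))).
Proof.
rewrite /exp_partial !big_ord_recr big_ord0/= !factS fact0 !natrM.
by field.
Qed.

Lemma expR_ge_horner y : 0 <= y ->
  1 + y * (1 + y / 2 * (1 + y / 3 * (1 + y / 4 * (1 + y / 5 *
    (1 + y / 6 * (1 + y / 7 * (1 + y / 8 * (1 + y / 9)))))))) <= expR y.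
Proof. by move=> y0; rewrite -exp_partial10E exp_partial_le. Qed.

Lemma expR_le_horner y : 0 <= y ->
  expR y * (1 - y ^+ 10 / (10 * (9 * (8 * 5040)))) <=
  1 + y * (1 + y / 2 * (1 + y / 3 * (1 + y / 4 * (1 + y / 5 *
    (1 + y / 6 * (1 + y / 7 * (1 + y / 8 * (1 + y / 9)))))))).
Proof.
move=> y0; rewrite -exp_partial10E; have := exp_remainder 10 y0.
rewrite (_ : 10`!%:R = 10 * (9 * (8 * 5040)) :> R); first lra.
rewrite !factS fact0 !natrM; lra.
Qed.

Lemma expR1_le : expR 1 <= 68 / 25 :> R.
Proof.
have := @expR_le_horner 1 ler01; lra.
Qed.

Lemma expR_34_49_ge2 : 2 <= expR (34 / 49) :> R.
Proof.
have C0 : (0 : R) <= 34 / 49 by lra.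
apply: le_trans (expR_ge_horner C0); lra.
Qed.

(** With [s = x - 1], multiply by [expR (- s)] and use [expR (34 / 49) >= 2]:
    the claim becomes [2 expR (19/49 s + 34/49 s^2) >= 2 expR (- s) + s e],
    where Taylor bounds of low order suffice because [4 * (34 / 49) >= e]. *)
Lemma kerstan_factor_le_large x : 1 <= x ->
  2 - (1 - x) * expR x <= expR (34 / 49 * x ^+ 2).
Proof.
move=> x1; pose s := x - 1; have s0 : 0 <= s by rewrite subr_ge0.
have e2 : 2 * (1 + (19 / 49 * s + 34 / 49 * s ^+ 2)) <=
    expR (34 / 49 * x ^+ 2) * expR (- s).
  rewrite -expRD.
  rewrite (_ : _ + - s = 34 / 49 + (19 / 49 * s + 34 / 49 * s ^+ 2)).
    rewrite expRD; apply: ler_pM; [by []| |exact: expR_34_49_ge2|exact: expR_ge1Dx].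
    by have := sqr_ge0 s; lra.
  by rewrite /s; lra.
have e3 := expRN_le_quadratic s0.
have s2 := sqr_ge0 s.
rewrite -(ler_pM2r (expR_gt0 (- s))); apply: le_trans e2.
rewrite mulrBl -[(1 - x) * _ * _]mulrA -expRD (_ : x + - s = 1); last by rewrite /s; lra.
rewrite (_ : 1 - x = - s) ?mulNr; last by rewrite /s; lra.
have e4 := ler_wpM2l s0 expR1_le.
lra.
Qed.

Lemma expR_44_47_ge : 2 + 11 / 20 + 1 / 71 / 72 <= expR (44 / 47 : R).
Proof.
have y0 : (0:R) <= 44 / 47 by lra.
apply: le_trans (expR_ge_horner y0); lra.
Qed.

(* About 0.69402592: above c1 by 1.1e-7 and still below 0.694026. *)
Local Notation C := (34 / 49 + 1 / 20 / 337 : R).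

Lemma expR_C_44_47_ge :
  2 - 7 / 43 + 1 / 284 / 284 <= expR (C * (44 / 47) ^+ 2).
Proof.
have y0 : (0:R) <= C * (44 / 47) ^+ 2 by lra.
apply: le_trans (expR_ge_horner y0); lra.
Qed.

(** The point [44 / 47] is within 1e-4 of the maximizer, where the two sides
    differ by about 1e-7 only. Cubic Taylor polynomials about this point reduce
    the claim to a polynomial inequality in [t = x - 44 / 47] with a nearly
    vanishing minimum at [t = 0]. *)
Lemma kerstan_factor_le_mid x : 13 / 20 <= x <= 1 ->
  2 - (1 - x) * expR x <= expR (C * x ^+ 2).
Proof.
move=> /andP[x0 x1].
have [t xE] : exists t, x = 44 / 47 + t by exists (x - 44 / 47); rewrite addrC subrK.
have [u uE] : exists u, u = C * (88 / 47 * t + t ^+ 2) by exists (C * (88 / 47 * t + t ^+ 2)).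
have CxE : C * x ^+ 2 = C * (44 / 47) ^+ 2 + u by rewrite uE xE; lra.
have u0 : - (1 / 3) <= u by nra.
have t0 : - (7 / 24) <= t by lra.
have t1 : t <= 3 / 47 by lra.
have cubic_ge0 w : - (1 / 3) <= w -> 0 <= 1 + w + w ^+ 2 / 2 + w ^+ 3 / 6 :> R.
  by move=> w0; nra.
have e1 : (2 - 7 / 43 + 1 / 284 / 284) * (1 + u + u ^+ 2 / 2 + u ^+ 3 / 6) <=
    expR (C * x ^+ 2).
  rewrite CxE expRD; apply: ler_pM; [|exact: cubic_ge0|exact: expR_C_44_47_ge|exact: expR_ge_cubic].
  by lra.
have e2 : (2 + 11 / 20 + 1 / 71 / 72) * (1 + t + t ^+ 2 / 2 + t ^+ 3 / 6) <=
    expR x.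
  rewrite xE expRD; apply: ler_pM; [| |exact: expR_44_47_ge|exact: expR_ge_cubic].
    by lra.
  by apply: cubic_ge0; lra.
have x1' : 0 <= 1 - x by lra.
have {}e2 := ler_wpM2l x1' e2.
suff : 0 <= (2 - 7 / 43 + 1 / 284 / 284) * (1 + u + u ^+ 2 / 2 + u ^+ 3 / 6) +
   (1 - x) * ((2 + 11 / 20 + 1 / 71 / 72) * (1 + t + t ^+ 2 / 2 + t ^+ 3 / 6)) - 2.
  by move: e1 e2; move: (expR _) (expR _) => E E' e1 e2; lra.
clear e1 e2 cubic_ge0 CxE u0 x1' x0 x1.
rewrite uE xE; clear uE xE u x.
(* The polynomial has the form p0 + p1 t + t^2 r(t), where p0 + p1 t + t^2 / 10
   is nonnegative by the first square, and r - 1/10 is a polynomial in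
   t + 7/24 >= 0 with nonnegative coefficients. *)
have h1 := sqr_ge0 (t - 1 / 84 / 85).
have s0 : 0 <= t + 7 / 24 by lra.
have t20 := sqr_ge0 t.
have h2 := mulr_ge0 t20 s0.
have h3 := mulr_ge0 t20 (exprn_ge0 2 s0).
have h4 := mulr_ge0 t20 (exprn_ge0 3 s0).
have h5 := mulr_ge0 t20 (exprn_ge0 4 s0).
lra.
Qed.

Lemma kerstan_factor_le x : 0 <= x -> 2 - (1 - x) * expR x <= expR (C * x ^+ 2).
Proof.
move=> x0.
have C0 : expR (34 / 49 * x ^+ 2) <= expR (C * x ^+ 2).
  by rewrite ler_expR; apply: ler_wpM2r; [exact: sqr_ge0|lra].
have [x1|x1] := lerP x (13 / 20).
  by apply: le_trans C0; apply: kerstan_factor_le_small; rewrite x0.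
have [x2|x2] := lerP x 1; first by apply: kerstan_factor_le_mid; rewrite (ltW x1).
by apply: le_trans C0; apply: kerstan_factor_le_large; exact: ltW.
Qed.

(** Positivity of the argument of [ln] in the definition of [c1]. *)
Lemma kerstan_factor_ge1 x : 1 <= 2 - (1 - x) * expR x.
Proof.
have : (1 - x) * expR x <= 1.
  have := expR_ge1Dx (- x); rewrite -(ler_pM2r (expR_gt0 x)).
  by rewrite -expRD addNr expR0.
lra.
Qed.

Let c1_ub :
  ubound [set ln (2 - (1 - x) * expR x) / x ^+ 2 | x in [set x : R | 0 < x]] C.
Proof.
move=> _ [x /= x0 <-]; rewrite ler_pdivrMr ?exprn_gt0//.
rewrite -ler_expR lnK ?posrE; first exact: kerstan_factor_le (ltW x0).
by apply: lt_le_trans (kerstan_factor_ge1 x).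
Qed.

Lemma kerstan_factor_le_c1 x : 0 <= x ->
  2 - (1 - x) * expR x <= expR (c1 R * x ^+ 2).
Proof.
rewrite le_eqVlt => /predU1P[<-|x0].
  by rewrite expR0 expr0n/= mulr0 expR0; lra.
have p0 : 0 < 2 - (1 - x) * expR x by apply: lt_le_trans (kerstan_factor_ge1 x).
rewrite -(lnK p0) ler_expR -ler_pdivrMr ?exprn_gt0//.
apply: ub_le_sup; first by exists C; exact: c1_ub.
by exists x.
Qed.

Lemma c1_lt : c1 R < 694 / 10 ^+ 3 + 26 / 10 ^+ 6.
Proof.
apply: (@le_lt_trans _ _ C); last lra.
apply: ge_sup; last exact: c1_ub.
by eexists; exists 1; [exact: ltr01|].
Qed.

Lemma c1_ge : 694 / 10 ^+ 3 + 25 / 10 ^+ 6 <= c1 R.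
Proof.
have x0 : 0 < 44 / 47 :> R by lra.
have y0 : 0 <= (694 / 10 ^+ 3 + 25 / 10 ^+ 6) * (44 / 47) ^+ 2 :> R by lra.
have h := kerstan_factor_le_c1 (ltW x0).
have h1 := expR_le_horner y0; have h2 := expR_le_horner (ltW x0).
suff : expR ((694 / 10 ^+ 3 + 25 / 10 ^+ 6) * (44 / 47) ^+ 2) <= expR (c1 R * (44 / 47) ^+ 2).
  by rewrite ler_expR; move=> H; lra.
apply: le_trans h; clear y0 x0.
move: (expR _) (expR _) h1 h2 => E E' h1 h2.
lra.
Qed.

Lemma c1_gt0 : 0 < c1 R.
Proof. apply: lt_le_trans c1_ge; lra. Qed.

Lemma c1_ge0 : 0 <= c1 R.
Proof. exact: ltW c1_gt0. Qed.

End exponential.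

(** * Elementary symmetric functions in a commutative seminormed algebra *)

(** The maximum over [x] of the quotient is [(2m / e)^(m/2) / m!], which is at
    most 1. Compared with the trivial bound by [expR x], the exponent is
    quadratic, which is what allows a common choice of the radius in
    [seminorm_elem_sym_le]. *)
Lemma expr_fact_le_gauss (R : realType) (x : R) m : 0 <= x ->
  x ^+ m / m`!%:R <= expR (x ^+ 2 / 4).
Proof.
move=> x0; set u := x ^+ 2 / 4 *+ 2.
have u0 : 0 <= u by rewrite mulrn_wge0// divr_ge0// sqr_ge0.
have f0 : 0 < m`!%:R :> R by rewrite ltr0n fact_gt0.
have e0 := expR_gt0 (x ^+ 2 / 4).
(* After squaring, u ^+ m <= m`! * expR u reduces the claim to 2 ^+ m <= m`!,
   which fails only for m = 1, 2, 3. *)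
suff H : 2 ^+ m * u ^+ m <= m`!%:R ^+ 2 * expR u.
  rewrite -(@ler_pXn2r _ 2)//; [|by rewrite nnegrE divr_ge0 ?exprn_ge0|by rewrite nnegrE ltW].
  rewrite -expRM_natl mulr_natl expr_div_n ler_pdivrMr ?exprn_gt0// mulrC.
  apply: le_trans H; rewrite -exprMn -exprM mulnC exprM.
  rewrite lerXn2r ?nnegrE ?sqr_ge0 ?mulr_ge0//.
  by rewrite /u; have := sqr_ge0 x; lra.
have [m4|m4] := ltnP m 4; last first.
  have H : 2 ^+ m <= m`!%:R :> R.
    rewrite -natrX ler_nat -(subnKC m4); elim: (m - 4)%N => // k IH.
    by rewrite addnS expnS factS leq_mul.
  rewrite expr2 -mulrA ler_pM ?exprn_ge0// mulrC -ler_pdivrMr//.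
  have := exp_partial_le m.+1 u0; rewrite /exp_partial big_ord_recr/=.
  by apply: le_trans; rewrite lerDr sumr_ge0// => i _; rewrite divr_ge0// exprn_ge0.
have : 1 + u + u ^+ 2 / 2 + u ^+ 3 / 6 + u ^+ 4 / 24 <= expR u.
  apply: le_trans (exp_partial_le 5 u0).
  rewrite /exp_partial !big_ord_recr !big_ord0/= !factS fact0 !natrM /=; lra.
move: (expR u) => E.
case: m m4 {f0} => [|[|[|[|m]]]] // _; rewrite ?factS fact0 ?natrM.
- rewrite !expr0; have := exprn_ge0 2 u0;  have := exprn_ge0 3 u0; have := exprn_ge0 4 u0; lra.
- have := exprn_ge0 3 u0; have := exprn_ge0 4 u0; have := sqr_ge0 (u - 1); lra.
- have := exprn_ge0 3 u0; have := exprn_ge0 4 u0; have := sqr_ge0 (u - 2);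
    have := sqr_ge0 (u ^+ 2 - u); nra.
- have := exprn_ge0 3 u0; have := exprn_ge0 4 u0; have := sqr_ge0 (u - 2);
    have := sqr_ge0 (u ^+ 2 - u *+ 2); nra.
Qed.

Section kerstan_bound.
Variables (R : realType) (A : comAlgType R).

(** Exponentials of [a z], truncated after degree [K]. All identities between
    formal power series in [z] are used modulo [z^(K+1)] ([eqp_upto]). *)
Definition exp_poly K (a : A) : {poly A} :=
  \poly_(i < K.+1) (i`!%:R^-1 *: a ^+ i).

(** The Taylor coefficients of [(1 + x) exp(- x)]. *)
Definition kerstan_coef i : R := (-1) ^+ i * (1 - i%:R) / i`!%:R.

Definition kerstan_poly K (a : A) : {poly A} :=
  \poly_(i < K.+1) (kerstan_coef i *: a ^+ i).

Definition eqp_upto K (p q : {poly A}) := forall i, (i <= K)%N -> p`_i = q`_i.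

Lemma eqp_uptoM K p q p' q' : eqp_upto K p p' -> eqp_upto K q q' ->
  eqp_upto K (p * q) (p' * q').
Proof.
move=> pp' qq' i iK; rewrite !coefM; apply: eq_bigr => j _.
by rewrite pp' ?qq'// (leq_trans _ iK)// ?leq_subr// -ltnS.
Qed.

Lemma eqp_upto_trans K p q r : eqp_upto K p q -> eqp_upto K q r -> eqp_upto K p r.
Proof. by move=> pq qr i iK; rewrite pq// qr. Qed.

Lemma eqp_upto_prod K (I : finType) (p q : I -> {poly A}) :
  (forall i, eqp_upto K (p i) (q i)) -> eqp_upto K (\prod_i p i) (\prod_i q i).
Proof.
move=> pq; apply: (big_ind2 (eqp_upto K)) => //.
by move=> *; exact: eqp_uptoM.
Qed.

Lemma exp_poly0 K : exp_poly K 0 = 1.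
Proof.
apply/polyP => -[|i]; rewrite coef_poly coef1/=.
  by rewrite expr0 invr1 scale1r.
by case: ifP => // _; rewrite expr0n/= scaler0.
Qed.

Lemma exp_polyD K a b : eqp_upto K (exp_poly K a * exp_poly K b) (exp_poly K (a + b)).
Proof.
move=> i iK; rewrite coefM coef_poly ltnS iK addrC exprDn scaler_sumr.
apply: eq_bigr => -[j /=]; rewrite ltnS => ji _.
rewrite !coef_poly !ltnS (leq_trans ji iK) (leq_trans (leq_subr _ _) iK).
rewrite -scalerAl -scalerAr scalerA [b ^+ _ * _]mulrC -[_ *+ 'C(i, j)]scaler_nat scalerA.
congr (_ *: _); rewrite -(bin_fact ji) !natrM.
have := fact_gt0 j; have := fact_gt0 (i - j); have : (0 < 'C(i, j))%N by rewrite bin_gt0.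
rewrite -!(ltr_nat R) => *; field; rewrite !lt0r_neq0//.
Qed.

Lemma exp_poly_sum K (I : finType) (a : I -> A) :
  eqp_upto K (\prod_i exp_poly K (a i)) (exp_poly K (\sum_i a i)).
Proof.
apply: (big_ind2 (fun p s => eqp_upto K p (exp_poly K s))) => //.
- by rewrite exp_poly0.
- move=> p a' q b' pa qb.
  exact: eqp_upto_trans (eqp_uptoM pa qb) (exp_polyD _ _).
Qed.

Lemma kerstan_polyE K a :
  eqp_upto K ((1 + a *: 'X) * exp_poly K (- a)) (kerstan_poly K a).
Proof.
move=> i iK; rewrite mulrDl mul1r -scalerAl coefD coefZ coefXM.
rewrite !coef_poly ltnS iK /kerstan_coef.
case: i iK => [|i] iK /=.
  by rewrite !expr0 mulr0 addr0 subr0 !mul1r.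
rewrite ltnS (leq_trans _ iK)// -scaleN1r !exprZn !scalerA -scalerAr -exprS.
rewrite -scalerDl; congr (_ *: _).
have := fact_gt0 i; rewrite factS natrM -(ltr_nat R) => i0.
have i1 : (0 : R) < i.+1%:R by rewrite ltr0n.
rewrite exprS -[i.+1%:R]natr1 in i1 *.
by field; rewrite !lt0r_neq0.
Qed.

Definition elem_sym (I : finType) k (a : I -> A) : A :=
  \sum_(J : {set I} | #|J| == k) \prod_(j in J) a j.

Lemma coef_prod_1DX (I : finType) (a : I -> A) k :
  (\prod_i (1 + a i *: 'X))`_k = elem_sym k a.
Proof.
rewrite (eq_bigr (fun i => (a i)%:P * 'X + 1)); last first.
  by move=> i _; rewrite addrC mul_polyC.
rewrite bigA_distr/= coef_sum /elem_sym [RHS]big_mkcond/=; apply: eq_bigr => J _.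
rewrite -big_mkcond/= big_split/= prodr_const -rmorph_prod/= coefCM coefXn.
by rewrite eq_sym; case: eqP => _; rewrite ?mulr1 ?mulr0.
Qed.

(** Comparison of coefficients in
    [prod_i (1 + a_i z) = exp(z sum_i a_i) prod_i (1 + a_i z) exp(- a_i z)]. *)
Lemma elem_sym_kerstan (I : finType) (a : I -> A) k :
  elem_sym k a = (exp_poly k (\sum_i a i) * \prod_i kerstan_poly k (a i))`_k.
Proof.
rewrite -coef_prod_1DX; symmetry.
have H : eqp_upto k (\prod_i kerstan_poly k (a i))
    (\prod_i (1 + a i *: 'X) * exp_poly k (- \sum_i a i)).
  apply: (eqp_upto_trans (q := \prod_i ((1 + a i *: 'X) * exp_poly k (- a i)))).
    by apply: eqp_upto_prod => i j jk; rewrite kerstan_polyE.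
  rewrite big_split/= -sumrN; apply: eqp_uptoM => //.
  exact: exp_poly_sum.
rewrite (eqp_uptoM (fun i _ => erefl) H (leqnn k)) mulrCA.
have E : eqp_upto k (exp_poly k (\sum_i a i) * exp_poly k (- \sum_i a i)) 1.
  by have := @exp_polyD k (\sum_i a i) (- \sum_i a i); rewrite subrr exp_poly0.
by rewrite (eqp_uptoM (fun i _ => erefl) E (leqnn k)) mulr1.
Qed.

Variable N : A -> R.
Hypotheses (ND : forall a b, N (a + b) <= N a + N b)
  (NM : forall a b, N (a * b) <= N a * N b)
  (NZ : forall c a, N (c *: a) = `|c| * N a)
  (N1 : N 1 <= 1) (N_ge0 : forall a, 0 <= N a).

Lemma seminorm_sum (I : Type) (r : seq I) (P : pred I) (a : I -> A) :
  N (\sum_(i <- r | P i) a i) <= \sum_(i <- r | P i) N (a i).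
Proof.
apply: (big_ind2 (fun a b => N a <= b)) => //.
  by rewrite -[X in N X](scale0r 0) NZ normr0 mul0r.
by move=> a' x b' y ax bx; apply: le_trans (ND _ _) _; exact: lerD.
Qed.

Lemma seminorm_exp a n : N (a ^+ n) <= N a ^+ n.
Proof.
elim: n => [|n IHn]; first by rewrite !expr0.
by rewrite !exprS; apply: le_trans (NM _ _) _; rewrite ler_wpM2l.
Qed.

Definition majorized (p : {poly A}) (q : {poly R}) := forall i, N p`_i <= q`_i.

Lemma majorizedM p q p' q' : majorized p p' -> majorized q q' ->
  majorized (p * q) (p' * q').
Proof.
move=> pp' qq' i; rewrite !coefM; apply: le_trans (seminorm_sum _ _ _) _.
by apply: ler_sum => j _; apply: le_trans (NM _ _) _; rewrite ler_pM.
Qed.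

Lemma majorized_prod (I : finType) (p : I -> {poly A}) (q : I -> {poly R}) :
  (forall i, majorized (p i) (q i)) -> majorized (\prod_i p i) (\prod_i q i).
Proof.
move=> pq; apply: (big_ind2 majorized) => //; last by move=> *; exact: majorizedM.
move=> [|i]; rewrite !coef1//=.
by rewrite -[X in N X](scale0r 0) NZ normr0 mul0r.
Qed.

Definition kerstan_majorant K (t : R) : {poly R} :=
  \poly_(i < K.+1) (`|kerstan_coef i| * t ^+ i).

Lemma kerstan_poly_majorized K a : majorized (kerstan_poly K a) (kerstan_majorant K (N a)).
Proof.
move=> i; rewrite !coef_poly; case: ifP => _.
  by rewrite NZ ler_wpM2l// seminorm_exp.
by rewrite -[X in N X](scale0r 0) NZ normr0 mul0r.
Qed.

Lemma kerstan_coef_sum K (x : R) :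
  \sum_(i < K.+1) `|kerstan_coef i| * x ^+ i =
  2 + (x * exp_partial x K - exp_partial x K.+1).
Proof.
rewrite /exp_partial !big_ord_recl/= /kerstan_coef fact0 !expr0 subr0 !mul1r.
rewrite invr1 normr1 mulr1 mulr_sumr.
set T := \sum_(i < K) x * _; set U := \sum_(i < K) x ^+ _ / _.
rewrite (_ : 2 + _ = 1 + (T - U)); last by lra.
rewrite /T /U -sumrB; congr (_ + _); apply: eq_bigr => i _; rewrite /bump/= add1n.
have i0 : (0 : R) < i`!%:R by rewrite ltr0n fact_gt0.
have i1 : (0 : R) < i.+1%:R by rewrite ltr0n.
rewrite !normrM normrX normrN1 expr1n mul1r normfV (@ger0_norm _ (_`!%:R))//.
rewrite factS natrM exprS -[i.+1%:R]natr1 in i1 *.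
rewrite opprD addrCA subrr addr0 normrN ger0_norm//.
by field; rewrite !lt0r_neq0.
Qed.

(** The left side is a partial sum of the power series of the right side; in
    the form of [kerstan_coef_sum] the partial sums are seen to increase. *)
Lemma kerstan_coef_sum_le K (x : R) : 0 <= x ->
  \sum_(i < K.+1) `|kerstan_coef i| * x ^+ i <= 2 - (1 - x) * expR x.
Proof.
move=> x0; rewrite kerstan_coef_sum lerD2l mulrBl mul1r opprB.
have cv : x * exp_partial x L - exp_partial x L.+1 @[L --> \oo] -->
    x * expR x - expR x.
  apply: cvgB; first by apply: cvgMr; exact: exp_partial_cvg.
  by rewrite (cvg_shiftS (exp_partial x)); exact: exp_partial_cvg.
rewrite -(cvg_lim _ cv)//.
apply: (nondecreasing_cvgn_le (u_ := fun L => x * exp_partial x L - exp_partial x L.+1));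
  last exact: cvgP cv.
apply/nondecreasing_seqP => L; rewrite /exp_partial.
rewrite [X in _ <= x * X - _]big_ord_recr [X in _ <= _ - X]big_ord_recr/=.
rewrite mulrDr opprD addrACA lerDl subr_ge0 mulrA -exprS factS.
rewrite ler_wpM2l ?exprn_ge0// lef_pV2 ?posrE ?ltr0n ?muln_gt0 ?fact_gt0//.
by rewrite ler_nat leq_pmull.
Qed.

Lemma kerstan_majorant_le K t r : 0 <= t -> 0 <= r ->
  (kerstan_majorant K t).[r] <= expR (c1 R * (r * t) ^+ 2).
Proof.
move=> t0 r0; apply: le_trans (kerstan_factor_le_c1 (mulr_ge0 r0 t0)).
apply: le_trans (kerstan_coef_sum_le K (mulr_ge0 r0 t0)).
rewrite horner_poly ler_sum// => i _; rewrite -mulrA -exprMn mulrC [t * r]mulrC.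
by rewrite mulrC.
Qed.

(** The first exponential factor of [elem_sym_kerstan] enters only through the
    largest of its weighted coefficients, bounded by [expr_fact_le_gauss], so that the
    remaining factors enter through the sum of all their weighted coefficients,
    which is the value at [r] of a product of majorants. *)
Lemma seminorm_elem_sym_le (I : finType) (a : I -> A) k r : 0 <= r ->
  N (elem_sym k a) * r ^+ k <=
  expR (r ^+ 2 * (N (\sum_i a i) ^+ 2 / 4 + c1 R * \sum_i N (a i) ^+ 2)).
Proof.
move=> r0; pose q := \prod_i kerstan_majorant k (N (a i)).
have qmaj : majorized (\prod_i kerstan_poly k (a i)) q.
  by apply: majorized_prod => i; exact: kerstan_poly_majorized.
have q0 i : 0 <= q`_i by apply: le_trans (qmaj i).
set s := N (\sum_i a i).
apply: (@le_trans _ _ (\sum_(j < k.+1) s ^+ j / j`!%:R * q`_(k - j) * r ^+ k)).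
  rewrite -mulr_suml ler_wpM2r ?exprn_ge0// elem_sym_kerstan coefM.
  apply: le_trans (seminorm_sum _ _ _) _; apply: ler_sum => j _.
  apply: le_trans (NM _ _) _; apply: ler_pM => //.
  rewrite coef_poly ltn_ord NZ ger0_norm ?invr_ge0// mulrC.
  by rewrite ler_wpM2r ?invr_ge0// seminorm_exp.
apply: (@le_trans _ _ (expR ((r * s) ^+ 2 / 4) * q.[r])); last first.
  rewrite mulrDr expRD exprMn [r ^+ 2 * (s ^+ 2 / 4)]mulrA ler_wpM2l ?expR_ge0//.
  rewrite mulrCA mulr_sumr mulr_sumr expR_sum /q horner_prod.
  apply: ler_prod => i _; apply/andP; split.
    by rewrite horner_poly sumr_ge0// => j _; rewrite !mulr_ge0 ?exprn_ge0.
  by rewrite -exprMn; exact: kerstan_majorant_le.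
apply: (@le_trans _ _ (expR ((r * s) ^+ 2 / 4) *
    \sum_(j < k.+1) q`_(k - j) * r ^+ (k - j))).
  rewrite mulr_sumr ler_sum// => j _.
  have jk : (j <= k)%N by rewrite -ltnS.
  rewrite (_ : r ^+ k = r ^+ j * r ^+ (k - j)); last by rewrite -exprD subnKC.
  rewrite [X in X <= _](_ : _ = ((r * s) ^+ j / j`!%:R) * (q`_(k - j) * r ^+ (k - j))).
    apply: ler_wpM2r; first by rewrite mulr_ge0 ?exprn_ge0.
    by apply: expr_fact_le_gauss; rewrite mulr_ge0 ?N_ge0.
  by rewrite exprMn; field; rewrite pnatr_eq0 -lt0n fact_gt0.
rewrite ler_wpM2l ?expR_ge0//.
rewrite (_ : \sum_(j < k.+1) _ = \sum_(j < k.+1) q`_j * r ^+ j); last first.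
  rewrite (reindex_inj rev_ord_inj); apply: eq_bigr => j _.
  by rewrite /= subSS subKn// -ltnS.
rewrite (horner_coef_wide _ (leq_maxr k.+1 (size q))).
rewrite (big_ord_widen _ (fun i => q`_i * r ^+ i) (leq_maxl k.+1 (size q))).
rewrite [leRHS](bigID (fun i : 'I__ => (i < k.+1)%N))/= lerDl.
by rewrite sumr_ge0// => i _; rewrite mulr_ge0 ?exprn_ge0.
Qed.
End kerstan_bound.

(** * The expansion of a product around a power *)

Lemma expn_leq_ffact m i : (i.+1 ^ m <= (i + m) ^_ m)%N.
Proof.
elim: m => [|m IH]; first by rewrite expn0 ffactn0.
by rewrite expnS addnS ffactSS leq_mul// ltnS leq_addr.
Qed.

Section power_series.
Variables (R : realType) (s : R).
Hypotheses (s0 : 0 <= s) (s1 : s < 1).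

(** A step of summation by parts through Pascal's rule, to be iterated in
    [sum_bin_le]. *)
Lemma sum_bin_succ m n :
  (1 - s) * (\sum_(i < n) 'C(i + m.+1, m.+1)%:R * s ^+ i) =
  (\sum_(i < n) 'C(i + m, m)%:R * s ^+ i) - 'C(n + m, m.+1)%:R * s ^+ n.
Proof.
elim: n => [|n IH]; first by rewrite !big_ord0 mulr0 add0n bin_small// mul0r subr0.
rewrite !big_ord_recr/= mulrDr IH addnS addSn !binS !natrD exprS.
ring.
Qed.

Lemma sum_bin_le m n :
  \sum_(i < n) 'C(i + m, m)%:R * s ^+ i <= ((1 - s) ^+ m.+1)^-1.
Proof.
have s10 : 0 < 1 - s by rewrite subr_gt0.
elim: m => [|m IH].
  rewrite expr1 -[leRHS]mul1r ler_pdivlMr//.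
  under eq_bigr do rewrite bin0 mul1r.
  by rewrite -opprB mulrN mulrC -subrX1 opprB gerBl exprn_ge0.
rewrite exprS invfM ler_pdivlMl//.
rewrite sum_bin_succ; apply: le_trans IH.
by rewrite gerBl mulr_ge0 ?exprn_ge0.
Qed.

(** Since [i + l + 1 <= (l + 1) (i + 1)] and [(i + 1)^m <= (i + m) ^_ m], the
    summands are at most those of [(l + 1)^m m!] times the binomial series of
    [(1 - s)^(-m-1)]. *)
Lemma sum_expn_geometric_le m l n :
  \sum_(i < n) (i + l.+1)%:R ^+ m * s ^+ i <=
  l.+1%:R ^+ m * m`!%:R / (1 - s) ^+ m.+1.
Proof.
apply: (@le_trans _ _ (\sum_(i < n) l.+1%:R ^+ m * m`!%:R *
   ('C(i + m, m)%:R * s ^+ i))); last first.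
  by rewrite -mulr_sumr ler_wpM2l ?sum_bin_le// mulr_ge0 ?exprn_ge0.
apply: ler_sum => i _; rewrite [leRHS]mulrA ler_wpM2r ?exprn_ge0//.
rewrite -!natrX -!natrM ler_nat -mulnA [(m`! * _)%N]mulnC bin_ffact.
apply: leq_trans (leq_mul (leqnn _) (expn_leq_ffact m i)).
case: m => [|m]; first by rewrite !expn0.
by rewrite -expnMn leq_exp2r// mulnS addnC leq_add2l leq_pmull.
Qed.
End power_series.

(** The choice [r^2 = k / (2 b)] minimizes the bound; if [b] vanishes, let [r]
    tend to infinity. *)
Lemma le_sqrt_exp_of_gauss (R : realType) (e b : R) (k : nat) : (0 < k)%N -> 0 <= e -> 0 <= b ->
  (forall r : R, 0 <= r -> e * r ^+ k <= expR (r ^+ 2 * b)) ->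
  e <= Num.sqrt (2 * expR 1 * b / k%:R) ^+ k.
Proof.
move=> k0 e0; rewrite le_eqVlt => /predU1P[<-|b0] H.
  rewrite mulr0 mul0r sqrtr0 expr0n gtn_eqF//= leNgt; apply/negP => e1.
  have r0 : 0 <= 1 + 2 / e by rewrite addr_ge0// divr_ge0.
  have := H _ r0; rewrite mulr0 expR0 leNgt => /negP; apply.
  rewrite -(prednK k0) exprS.
  have : 1 <= (1 + 2 / e) ^+ k.-1 by rewrite exprn_ege1// lerDl divr_ge0.
  move=> H1; apply: (@lt_le_trans _ _ (e * (1 + 2 / e))).
    by rewrite mulrDr mulrCA divff ?gt_eqF//; lra.
  by rewrite mulrA ler_peMr// mulr_ge0.
have k0' : 0 < k%:R :> R by rewrite ltr0n.
pose r : R := Num.sqrt (k%:R / (2 * b)).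
have r20 : 0 < k%:R / (2 * b) by rewrite divr_gt0// mulr_gt0.
have r0 : 0 < r by rewrite sqrtr_gt0.
have := H _ (ltW r0); rewrite -ler_pdivlMr ?exprn_gt0//.
move/le_trans; apply.
rewrite ler_pdivrMr ?exprn_gt0// -exprMn /r -sqrtrM; last first.
  by rewrite divr_ge0// ?mulr_ge0 ?expR_ge0// ltW.
rewrite sqr_sqrtr; last exact: ltW.
rewrite (_ : 2 * expR 1 * b / k%:R * (k%:R / (2 * b)) = expR (1 / 2) ^+ 2); last first.
  rewrite -expRM_natl (_ : 2 * (1 / 2) = 1 :> R); last by field.
  by move: (expR 1) => E; field; rewrite !lt0r_neq0.
rewrite sqrtr_sqr ger0_norm ?expR_ge0// -expRM_natl.
rewrite (_ : k%:R / (2 * b) * b = k%:R * (1 / 2)); last first.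
  by field; rewrite lt0r_neq0.
by [].
Qed.

Section expansion.
Variables (R : realType) (A : comAlgType R) (N : A -> R).
Hypotheses (ND : forall a b, N (a + b) <= N a + N b)
  (NM : forall a b, N (a * b) <= N a * N b)
  (NZ : forall c a, N (c *: a) = `|c| * N a)
  (N1 : N 1 <= 1) (N_ge0 : forall a, 0 <= N a).
Variables (n : nat) (f : 'I_n -> A) (g : A).
Hypothesis Ng : N g <= 1.

Let e k : A := elem_sym k (fun j => f j - g) * g ^+ (n - k).
Let M k j := (f j - g) * g ^+ ((n - k) %/ k).
Let Y k := N (\sum_j M k j) ^+ 2 / (4 * c1 R) + \sum_j N (M k j) ^+ 2.

Lemma prod_elem_sym : \prod_j f j = \sum_(k < n.+1) e k.
Proof.
rewrite (eq_bigr (fun j => (f j - g) + g)); last by move=> j _; rewrite subrK.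
rewrite bigA_distr/=.
(* Sort the subsets by their cardinality, which is at most n. *)
rewrite (partition_big (fun J : {set 'I_n} => inord #|J| : 'I_n.+1) xpredT)//=.
apply: eq_bigr => k _; rewrite /e /elem_sym mulr_suml.
apply: eq_big => [J|J Jk].
  rewrite -val_eqE/= inordK//.
  by rewrite ltnS -[leqRHS](card_ord n) max_card.
rewrite [LHS](bigID (mem J))/=; congr (_ * _).
  by apply: eq_bigr => i ->.
rewrite (eq_bigr (fun=> g)); last by move=> i /negbTE ->.
rewrite (eq_bigl (mem (~: J))) => [|i]; last by rewrite /= inE.
rewrite prodr_const cardsCs finset.setCK card_ord -(eqP Jk) inordK//.
by rewrite ltnS -[leqRHS](card_ord n) max_card.
Qed.

Lemma elem_sym_scale (I : finType) (a : I -> A) (b : A) k :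
  elem_sym k (fun i => a i * b) = elem_sym k a * b ^+ k.
Proof.
rewrite /elem_sym mulr_suml; apply: eq_bigr => J /eqP <-.
by rewrite big_split/= prodr_const.
Qed.

Lemma Y_ge0 k : 0 <= Y k.
Proof.
apply: addr_ge0; last by apply: sumr_ge0 => j _; exact: sqr_ge0.
by apply: divr_ge0; [exact: sqr_ge0|rewrite mulr_ge0 ?c1_ge0].
Qed.

(** The power [g ^+ (n - k)] provides one factor [g ^+ ((n - k) %/ k)] for each
    of the [k] factors in a term of the elementary symmetric function. *)
Lemma seminorm_expansion_term_le k : (0 < k <= n)%N ->
  N (e k) <= Num.sqrt (2 * expR 1 * c1 R * Y k / k%:R) ^+ k.
Proof.
move=> /andP[k0 kn].
have -> : e k = elem_sym k (M k) * g ^+ (n - k - (n - k) %/ k * k).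
  rewrite /e /M elem_sym_scale -mulrA -exprM -exprD subnKC//; exact: leq_trunc_div.
have c0 := c1_gt0 R.
apply: le_trans (NM _ _) _; apply: (@le_trans _ _ (N (elem_sym k (M k)) * 1)).
  rewrite ler_wpM2l//; apply: le_trans (seminorm_exp NM N1 N_ge0 _ _) _.
  by rewrite exprn_ile1.
rewrite mulr1 -(mulrA _ (c1 R)); apply: le_sqrt_exp_of_gauss => //.
  by rewrite mulr_ge0 ?c1_ge0 ?Y_ge0.
move=> r r0; apply: le_trans (seminorm_elem_sym_le ND NM NZ N1 N_ge0 _ _ r0) _.
rewrite ler_expR ler_wpM2l ?sqr_ge0// /Y mulrDr lerD2r.
by rewrite le_eqVlt; apply/orP; left; apply/eqP; field; rewrite lt0r_neq0.
Qed.

Definition algebra_eta l alpha : R :=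
  \big[Num.max/0]_(l.+1 <= k < n.+1) ((k%:R `^ (1 + alpha))^-1 * Y k).

Lemma Y_le_eta l alpha k : (l < k <= n)%N ->
  Y k <= k%:R `^ (1 + alpha) * algebra_eta l alpha.
Proof.
move=> /andP[lk kn].
have k0 : 0 < k%:R `^ (1 + alpha) :> R by rewrite powR_gt0// ltr0n (leq_ltn_trans _ lk).
rewrite -ler_pdivrMl// /algebra_eta.
apply: (@le_bigmax_seq _ _ _ _ _ k xpredT (fun k => (k%:R `^ (1 + alpha))^-1 * Y k)) => //.
by rewrite mem_index_iota ltnS lk.
Qed.

Lemma prod_sub_partial l : (l <= n)%N ->
  \prod_j f j - \sum_(0 <= k < l.+1) e k = \sum_(l.+1 <= k < n.+1) e k.
Proof.
move=> ln; rewrite prod_elem_sym -(big_mkord xpredT e).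
by rewrite (@big_cat_nat _ _ _ l.+1)//= addrAC subrr add0r.
Qed.

(** The k-th term is at most [v^(k/2)] with [v = 2 e c1 Y_k / k]. Here the factor
    [v^((l+1)/2)] is at most [k^beta] times a power of the [alpha]-dependent
    maximum, and the rest is at most [s^((k-l-1)/2)]. *)
Lemma seminorm_prod_sub_le (alpha : R) l : 0 <= alpha -> (l <= n)%N ->
  let beta := `|Num.ceil (alpha * l.+1%:R / 2)|%N in
  let s := 2 * expR 1 * c1 R * algebra_eta l 0 in
  s < 1 ->
  N (\prod_j f j - \sum_(0 <= k < l.+1) e k) <=
  l.+1%:R ^+ beta * beta`!%:R *
  ((2 * expR 1 * c1 R * algebra_eta l alpha) `^ (l.+1%:R / 2) /
           (1 - Num.sqrt s) ^+ beta.+1).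
Proof.
move=> alpha0 ln beta s' s1'; set w := 2 * expR 1 * c1 R * algebra_eta l alpha.
have K0 : 0 <= 2 * expR 1 * c1 R by rewrite !mulr_ge0 ?expR_ge0 ?c1_ge0.
have eta0 a : 0 <= algebra_eta l a by exact: bigmax_ge_id.
set s := Num.sqrt s'.
have w0 : 0 <= w by rewrite mulr_ge0.
have s0 : 0 <= s by exact: sqrtr_ge0.
have s1 : s < 1 by rewrite -sqrtr1 ltr_sqrt.
rewrite prod_sub_partial//; apply: le_trans (seminorm_sum ND NZ _ _ _) _.
apply: (@le_trans _ _ (\sum_(l.+1 <= k < n.+1)
   w `^ (l.+1%:R / 2) * (k%:R ^+ beta * s ^+ (k - l.+1)))); last first.
  rewrite -mulr_sumr mulrCA ler_wpM2l ?powR_ge0//.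
  rewrite -{1}[l.+1]add0n big_addn big_mkord.
  under eq_bigr do rewrite addnK.
  exact: sum_expn_geometric_le.
rewrite big_seq_cond [leRHS]big_seq_cond; apply: ler_sum => k.
rewrite mem_index_iota andbT ltnS => lkn; have /andP[lk kn] := lkn.
have k0 : (0 < k)%N by rewrite (leq_ltn_trans _ lk).
have k0' : (0 : R) < k%:R by rewrite ltr0n.
apply: le_trans (seminorm_expansion_term_le _) _; first by rewrite k0.
set v := 2 * expR 1 * c1 R * Y k / k%:R.
have v0 : 0 <= v by rewrite divr_ge0// mulr_ge0 ?Y_ge0.
have vs : v <= s'.
  rewrite ler_pdivrMr// /s' -[leRHS]mulrA ler_wpM2l// mulrC.
  have := Y_le_eta 0 lkn; rewrite addr0 powRr1; first by [].
  exact: ltW.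
have vw : v <= k%:R `^ alpha * w.
  rewrite ler_pdivrMr//.
  rewrite (_ : _ * w * _ = 2 * expR 1 * c1 R * (k%:R `^ (1 + alpha) * algebra_eta l alpha)).
    by rewrite ler_wpM2l// Y_le_eta.
  rewrite powRD; last by apply/implyP => _; rewrite gt_eqF.
  rewrite powRr1; last exact: ltW.
  rewrite /w; ring.
rewrite -{1}(subnKC lk) exprD mulrA ler_pM ?exprn_ge0 ?sqrtr_ge0//; last first.
  by rewrite lerXn2r ?nnegrE ?sqrtr_ge0// ler_sqrt// (le_trans v0).
apply: (@le_trans _ _ ((k%:R `^ alpha * w) `^ (l.+1%:R / 2))).
  rewrite -powR12_sqrt// -powR_mulrn ?powR_ge0// -powRrM mulrC.
  apply: ge0_ler_powR; [exact: divr_ge0|by []| |by []].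
  by rewrite nnegrE mulr_ge0 ?powR_ge0.
rewrite powRM ?powR_ge0// mulrC ler_wpM2l ?powR_ge0//.
rewrite -powRrM -powR_mulrn; last exact: ltW.
apply: ler_powR; first by rewrite ler1n.
rewrite /beta natr_absz ger0_norm; first by rewrite mulrA ceil_ge.
rewrite ceil_ge0; apply: lt_le_trans (ltrN10 _) _.
by rewrite divr_ge0// mulr_ge0.
Qed.

End expansion.

(** * Bounded measurable functions *)

Lemma sum_ltn K t : (\sum_(k < K) (k < t) = minn K t)%N.
Proof.
elim: K => [|K IH]; first by rewrite big_ord0 min0n.
by rewrite big_ord_recr/= IH; case: ltnP => Kt; rewrite ?addn1 ?addn0;
  rewrite ?(minn_idPl (ltnW Kt)) ?(minn_idPl Kt)// !(minn_idPr _)// ltnW.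
Qed.

Section bounded_measurable.
Context d (T : measurableType d) (R : realType).
Implicit Types (f g : T -> R) (A : set T).

Definition bmeas f := measurable_fun [set: T] f /\ exists M, forall x, `|f x| <= M.

Lemma bmeas_cst c : bmeas (fun=> c).
Proof. by split; [exact: measurable_cst|exists `|c|]. Qed.

Lemma bmeasD f g : bmeas f -> bmeas g -> bmeas (fun x => f x + g x).
Proof.
move=> [mf [M fM]] [mg [M' gM']]; split; first exact: measurable_funD.
by exists (M + M') => x; apply: le_trans (ler_normD _ _) (lerD _ _).
Qed.

Lemma bmeasM f g : bmeas f -> bmeas g -> bmeas (fun x => f x * g x).
Proof.
move=> [mf [M fM]] [mg [M' gM']]; split; first exact: measurable_funM.
by exists (M * M') => x; rewrite normrM ler_pM.
Qed.

Lemma bmeasZ c f : bmeas f -> bmeas (fun x => c * f x).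
Proof. by move=> bf; apply: bmeasM => //; exact: bmeas_cst. Qed.

Lemma bmeasB f g : bmeas f -> bmeas g -> bmeas (fun x => f x - g x).
Proof.
move=> bf bg; rewrite (_ : (fun x => _) = fun x => f x + (-1) * g x).
  by apply: bmeasD => //; exact: bmeasZ.
by apply/funext => x; rewrite mulN1r.
Qed.

Lemma bmeas_sum n (f : nat -> T -> R) : (forall i, bmeas (f i)) ->
  bmeas (fun x => \sum_(i < n) f i x).
Proof.
move=> bf; elim: n => [|n IH].
  by under eq_fun do rewrite big_ord0; exact: bmeas_cst.
by under eq_fun do rewrite big_ord_recr/=; exact: bmeasD.
Qed.

Lemma bmeas_indic A : measurable A -> bmeas (\1_A).
Proof.
move=> mA; split; first exact: measurable_indic.
by exists 1 => x; rewrite indicE; case: (_ \in _); rewrite ?normr1// normr0.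
Qed.

Lemma bmeas_integrable (m : {measure set T -> \bar R}) f :
  (m setT < +oo)%E -> bmeas f -> m.-integrable setT (EFin \o f).
Proof.
move=> moo [mf [M fM]]; apply: measurable_bounded_integrable => //.
exists M; split; first exact: num_real.
by move=> x Mx t _; apply: le_trans (fM t) (ltW Mx).
Qed.

(** These functionals are determined by their values at indicators
    ([bounded_linear_ext]), which replaces integration with respect to the
    various signed measures built below by evaluation on sets. *)
Definition bounded_linear (L : (T -> R) -> R) :=
  [/\ forall f g, bmeas f -> bmeas g -> L (fun x => f x + g x) = L f + L g,
      forall c f, bmeas f -> L (fun x => c * f x) = c * L f &
      exists C, forall f M, bmeas f -> (forall x, `|f x| <= M) -> `|L f| <= C * M].

Lemma bmeas_simple_sum (c : nat -> R) (A : nat -> set T) n :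
  (forall k, measurable (A k)) -> bmeas (fun x => \sum_(k < n) c k * \1_(A k) x).
Proof.
move=> mA; apply: (@bmeas_sum n (fun k x => c k * \1_(A k) x)) => i.
exact/bmeasZ/bmeas_indic.
Qed.

(** Uniform approximation by the layers [{f + M >= (k+1) / (n+1)}]: the number
    of the layers containing [x] is the integer part of [(n+1) (f x + M)]. *)
Lemma bmeas_approx f n : bmeas f -> exists (K : nat) (c : nat -> R) (A : nat -> set T),
  (forall k, measurable (A k)) /\
  forall x, `|f x - \sum_(k < K) c k * \1_(A k) x| <= n.+1%:R^-1.
Proof.
move=> [mf [M fM]].
pose v x := n.+1%:R * (f x + M); pose K := Num.truncn (n.+1%:R * (M + M)).
exists K.+1, (fun k => if k is 0%N then - M else n.+1%:R^-1),
  (fun k => if k is k.+1 then [set x | k.+1%:R <= v x] else setT).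
split=> [[|k]|x]; first exact: measurableT.
  rewrite -[X in measurable X]setTI.
  apply: (measurable_fun_le measurableT (measurable_cst _)).
  apply: measurable_funM; first exact: measurable_cst.
  by apply: measurable_funD => //; exact: measurable_cst.
have /ler_normlP[fM1 fM2] := fM x.
have n0 : (0 : R) < n.+1%:R by rewrite ltr0n.
have v0 : 0 <= v x by rewrite mulr_ge0//; lra.
have vK : (Num.truncn (v x) <= K)%N by rewrite le_truncn// ler_wpM2l// lerD2r.
rewrite big_ord_recl/= indicT mulr1.
rewrite (eq_bigr (fun k : 'I_K => n.+1%:R^-1 * (k < Num.truncn (v x))%:R)); last first.
  move=> k _; rewrite indicE/= ?add1n truncn_gt_nat; congr (_ * (nat_of_bool _)%:R).
  by apply/idP/idP; rewrite ?inE//= => /set_mem.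
rewrite -mulr_sumr -natr_sum (_ : (\sum_(i < K) _)%N = Num.truncn (v x)); last first.
  by rewrite sum_ltn; apply/minn_idPr.
have /andP[] := truncn_itv v0; rewrite -natr1 => t1 t2.
rewrite (_ : f x - _ = n.+1%:R^-1 * (v x - (Num.truncn (v x))%:R)); last first.
  by rewrite /v; field; rewrite addrC natr1 lt0r_neq0.
rewrite normrM normfV (ger0_norm (ltW n0)) ler_piMr// ?invr_ge0 ?ltW//.
by rewrite ger0_norm; lra.
Qed.

Lemma bounded_linear_simple L : bounded_linear L ->
  forall (c : nat -> R) (A : nat -> set T) n, (forall k, measurable (A k)) ->
  L (fun x => \sum_(k < n) c k * \1_(A k) x) = \sum_(k < n) c k * L \1_(A k).
Proof.
move=> [LD LZ _] c A n mA; elim: n => [|n IH].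
  rewrite big_ord0 -[RHS](mul0r (L (fun=> 0))) -LZ; last exact: bmeas_cst.
  by congr L; apply/funext => x; rewrite big_ord0 mul0r.
rewrite big_ord_recr/= -IH -LZ; last exact: bmeas_indic.
rewrite -LD; [|exact: bmeas_simple_sum|exact/bmeasZ/bmeas_indic].
by congr L; apply/funext => x; rewrite big_ord_recr.
Qed.

Lemma bounded_linear_ext (L L' : (T -> R) -> R) :
  bounded_linear L -> bounded_linear L' ->
  (forall A, measurable A -> L \1_A = L' \1_A) ->
  forall f, bmeas f -> L f = L' f.
Proof.
move=> bL bL' LL' f bf; apply/eqP; rewrite -subr_eq0 -normr_le0.
have [LD LZ [C LC]] := bL; have [L'D L'Z [C' LC']] := bL'.
have H n : `|L f - L' f| <= (C + C') * n.+1%:R^-1.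
  have [K [c [A [mA fA]]]] := bmeas_approx n bf.
  set s := (fun x => \sum_(k < K) c k * \1_(A k) x).
  have bs : bmeas s by exact: bmeas_simple_sum.
  have bfs : bmeas (fun x => f x - s x) by exact: bmeasB.
  have fE : f = (fun x => (f x - s x) + s x) by apply/funext => x; rewrite subrK.
  rewrite fE LD// L'D// (bounded_linear_simple bL)// (bounded_linear_simple bL')//.
  rewrite [X in _ + X - _](eq_bigr (fun k : 'I_K => c k * L' \1_(A k))); last first.
    by move=> k _; rewrite LL'.
  rewrite opprD addrACA subrr addr0; apply: le_trans (ler_normB _ _) _.
  by rewrite mulrDl lerD// ?LC ?LC'.
apply/ler_addgt0Pr => e e0; rewrite add0r.
have [CC|CC] := leP (C + C') 0.
  apply: le_trans (H 0%N) _; rewrite invr1 mulr1; lra.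
have := H (Num.truncn ((C + C') / e)); move/le_trans; apply.
rewrite ler_pdivrMr ?ltr0n// -ler_pdivrMl// mulrC ltW//.
exact: truncnS_gt.
Qed.

Lemma bounded_linearD (L L' : (T -> R) -> R) : bounded_linear L ->
  bounded_linear L' -> bounded_linear (fun f => L f + L' f).
Proof.
move=> [LD LZ [C LC]] [L'D L'Z [C' LC']]; split.
- by move=> f g bf bg; rewrite LD// L'D//; lra.
- by move=> c f bf; rewrite LZ// L'Z//; lra.
- exists (C + C') => f M bf fM; apply: le_trans (ler_normD _ _) _.
  by rewrite mulrDl lerD ?LC ?LC'.
Qed.

Lemma bounded_linearZ c (L : (T -> R) -> R) : bounded_linear L ->
  bounded_linear (fun f => c * L f).
Proof.
move=> [LD LZ [C LC]]; split.
- by move=> f g bf bg; rewrite LD// mulrDr.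
- by move=> a f bf; rewrite LZ// mulrCA.
- by exists (`|c| * C) => f M' bf fM; rewrite normrM -mulrA ler_wpM2l// LC.
Qed.

Lemma bounded_linearB (L L' : (T -> R) -> R) : bounded_linear L ->
  bounded_linear L' -> bounded_linear (fun f => L f - L' f).
Proof.
move=> bL bL'; have := bounded_linearD bL (bounded_linearZ (-1) bL').
by under eq_fun do rewrite mulN1r.
Qed.

End bounded_measurable.

(** * Signed measures as functionals *)

Section charge_functional.
Context d (T : measurableType d) (R : realType).
Local Notation M := (charge T R).
Implicit Types (V W : M) (f g u : T -> R) (A : set T) (m : {finite_measure set T -> \bar R}).

Lemma fin_measT m : (m setT < +oo)%E.
Proof. by rewrite -ge0_fin_numE// fin_num_measure. Qed.
Hint Resolve fin_measT : core.

Lemma bmeas_intf m f : bmeas f -> m.-integrable setT (EFin \o f).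
Proof. by apply: bmeas_integrable; exact: fin_measT. Qed.

Definition integ m f : R := \int[m]_x f x.

Lemma integ_bounded_linear m : bounded_linear (integ m).
Proof.
split.
- by move=> f g bf bg; apply: RintegralD => //; exact: bmeas_intf.
- by move=> c f bf; apply: RintegralZl => //; exact: bmeas_intf.
- exists (fine (m setT)) => f C bf fC; rewrite /integ.
  apply: le_trans (le_normr_Rintegral _ (bmeas_intf m bf)) _ => //.
  rewrite mulrC -(@Rintegral_cst _ _ _ m setT measurableT C).
  apply: le_Rintegral => //; apply: bmeas_intf; last exact: bmeas_cst.
  split; first by apply: measurableT_comp => //; case: bf.
  by exists C => x; rewrite normr_id.
Qed.

Lemma integ_indic m A : measurable A -> integ m \1_A = fine (m A).
Proof. by move=> mA; rewrite /integ /Rintegral integral_indic// setIT. Qed.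

(** Integration against a signed measure. On bounded measurable functions it
    does not depend on the chosen Hahn decomposition, by [cint_unique]. *)
Definition cint V f : R := integ (charge_pos V) f - integ (charge_neg V) f.

Lemma cint_bounded_linear V : bounded_linear (cint V).
Proof. by apply: bounded_linearB; exact: integ_bounded_linear. Qed.

Lemma cintD V f g : bmeas f -> bmeas g ->
  cint V (fun x => f x + g x) = cint V f + cint V g.
Proof. by have [+ _ _] := cint_bounded_linear V; apply. Qed.

Lemma cintZ V c f : bmeas f -> cint V (fun x => c * f x) = c * cint V f.
Proof. by have [_ + _] := cint_bounded_linear V; apply. Qed.

Lemma cint_indic V A : measurable A -> cint V \1_A = fine (V A).
Proof.
by move=> mA; rewrite /cint !integ_indic// charge_pos_negE// fineB// fin_num_measure.
Qed.

Lemma cint_unique V L : bounded_linear L ->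
  (forall A, measurable A -> L \1_A = fine (V A)) ->
  forall f, bmeas f -> L f = cint V f.
Proof.
move=> bL LV; apply: bounded_linear_ext => // [|A mA].
  exact: cint_bounded_linear.
by rewrite LV// cint_indic.
Qed.

Lemma eq_cint V W : (forall A, measurable A -> V A = W A) ->
  forall f, bmeas f -> cint V f = cint W f.
Proof.
move=> VW; apply: cint_unique; first exact: cint_bounded_linear.
by move=> A mA; rewrite cint_indic// VW.
Qed.

Lemma cint_saddm V W f : bmeas f -> cint (cadd V W) f = cint V f + cint W f.
Proof.
move=> bf; symmetry; move: f bf; apply: cint_unique.
  by apply: bounded_linearD; exact: cint_bounded_linear.
by move=> A mA; rewrite !cint_indic// /cadd/= fineD// fin_num_measure.
Qed.

Lemma cint_cscale c V f : bmeas f -> cint (cscale c V) f = c * cint V f.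
Proof.
move=> bf; symmetry; move: f bf; apply: cint_unique.
  exact/bounded_linearZ/cint_bounded_linear.
by move=> A mA; rewrite cint_indic// /cscale fineM// fin_num_measure.
Qed.

Lemma cint_copp V f : bmeas f -> cint (copp V) f = - cint V f.
Proof.
move=> bf; rewrite -mulN1r -cint_cscale//; apply: eq_cint => // A mA.
by rewrite [RHS](congr1 (fun h => h A) (cscaleN1 V)).
Qed.

Lemma cint_ssubm V W f : bmeas f -> cint (cadd V (copp W)) f = cint V f - cint W f.
Proof. by move=> bf; rewrite cint_saddm// cint_copp. Qed.

Lemma cint_measure m f : bmeas f -> cint (charge_of_finite_measure m) f = integ m f.
Proof.
move=> bf; symmetry; move: f bf; apply: cint_unique; first exact: integ_bounded_linear.
by move=> A mA; rewrite integ_indic.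
Qed.

Lemma cint_czero f : bmeas f -> cint czero f = 0.
Proof.
move=> bf; symmetry; move: f bf; apply: cint_unique; last by move=> A _; rewrite /czero.
split; [by move=> *; rewrite addr0|by move=> *; rewrite mulr0|exists 0 => *].
by rewrite normr0 mul0r.
Qed.

Lemma tvnormE V : tvnorm V = integ (charge_pos V) (fun=> 1) + integ (charge_neg V) (fun=> 1).
Proof.
rewrite /integ !Rintegral_cst// !mul1r /tvnorm /charge_variation.
by rewrite fineD// fin_num_measure.
Qed.

Lemma cint_le_tvnorm V f C : bmeas f -> (forall x, `|f x| <= C) ->
  `|cint V f| <= C * tvnorm V.
Proof.
move=> bf fC; rewrite tvnormE mulrDr; apply: le_trans (ler_normB _ _) _.
have H m : `|integ m f| <= C * integ m (fun=> 1).
  have [_ LZ _] := integ_bounded_linear m.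
  rewrite -LZ; last exact: bmeas_cst.
  apply: le_trans (le_normr_Rintegral _ (bmeas_intf m bf)) _ => //.
  apply: le_Rintegral => //.
  - apply: bmeas_intf; split; first by apply: measurableT_comp => //; case: bf.
    by exists C => x; rewrite normr_id.
  - by apply: bmeas_intf; under eq_fun do rewrite mulr1; exact: bmeas_cst.
  - by move=> x _; rewrite mulr1.
by rewrite lerD.
Qed.

(** The function is [1] on the positive part and [-1] on the negative part of a
    Hahn decomposition. Together with [cint_le_tvnorm] this describes the total
    variation as a dual norm, from which all its properties are derived. *)
Lemma tvnorm_attained V : exists u, [/\ bmeas u, forall x, `|u x| <= 1 &
  tvnorm V = cint V u].
Proof.
have := svalP (hahn_pair V); set P := (sval _).1; set N := (sval _).2.
move=> h; have [posP negN PNT PN0] := h.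
have mP : measurable P by case: posP.
have mN : measurable N by case: negN.
have bu : bmeas (fun x => \1_P x - \1_N x : R).
  by apply: bmeasB; exact: bmeas_indic.
exists (fun x => \1_P x - \1_N x); split => //.
  move=> x; rewrite !indicE; case: (boolP (x \in P)); case: (boolP (x \in N)) => /= _ _;
  by rewrite ?subrr ?subr0 ?sub0r ?normrN ?normr1 ?normr0.
have -> : cint V (fun x => \1_P x - \1_N x) = cint V \1_P - cint V \1_N.
  rewrite -[- cint V \1_N]mulN1r -cintZ; last exact: bmeas_indic.
  rewrite -cintD; [|exact: bmeas_indic|exact/bmeasZ/bmeas_indic].
  by congr cint; apply/funext => x; rewrite mulN1r.
rewrite !cint_indic// /tvnorm /charge_variation/=.
rewrite jordan_posE jordan_negE cjordan_posE cjordan_negE /crestr0 mem_set//.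
by rewrite /crestr !setTI fineB// fin_num_measure.
Qed.

Lemma tvnorm_le V C : (forall u, bmeas u -> (forall x, `|u x| <= 1) -> cint V u <= C) ->
  tvnorm V <= C.
Proof. by move=> H; have [u [bu u1 ->]] := tvnorm_attained V; exact: H. Qed.

Lemma tvnorm_ge0 V : 0 <= tvnorm V.
Proof. by rewrite /tvnorm fine_ge0. Qed.

Lemma eq_tvnorm V W : (forall f, bmeas f -> cint V f = cint W f) -> tvnorm V = tvnorm W.
Proof.
move=> VW; apply/le_anti/andP; split; apply: tvnorm_le => u bu u1.
  rewrite VW//; apply: le_trans (ler_norm _) _.
  by rewrite -[leRHS]mul1r cint_le_tvnorm.
rewrite -VW//; apply: le_trans (ler_norm _) _.
by rewrite -[leRHS]mul1r cint_le_tvnorm.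
Qed.
End charge_functional.

(** * Convolution of signed measures as functionals *)

Section fubini_charge.
Context d (T : measurableType d) (R : realType).
Local Notation M := (charge T R).
Implicit Types (V W : M) (m : {finite_measure set T -> \bar R}) (F : T * T -> R).

Lemma bmeas_pair1 F x : bmeas F -> bmeas (fun y => F (x, y)).
Proof.
move=> [mF [C FC]]; split; last by exists C => y.
exact: measurableT_comp mF (pair1_measurable x).
Qed.

Lemma bmeas_pair2 F y : bmeas F -> bmeas (fun x => F (x, y)).
Proof.
move=> [mF [C FC]]; split; last by exists C => x.
exact: measurableT_comp mF (pair2_measurable y).
Qed.

Lemma bmeas_swap F : bmeas F -> bmeas (fun p => F (p.2, p.1)).
Proof.
move=> [mF [C FC]]; split; last by exists C => p.
by apply: (measurableT_comp mF); apply: measurable_fun_pair;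
  [exact: measurable_snd|exact: measurable_fst].
Qed.

Lemma integrable_prod m1 m2 F : bmeas F -> (m1 \x m2)%E.-integrable setT (EFin \o F).
Proof.
have E : ((m1 \x m2) setT = m1 setT * m2 setT)%E.
  by rewrite -setXTT product_measure1E.
apply: bmeas_integrable; apply: (@le_lt_trans _ _ (m1 setT * m2 setT)%E).
  by rewrite -E.
by rewrite -ge0_fin_numE ?mule_ge0// fin_numM// fin_num_measure.
Qed.

Lemma integ_EFin m f : bmeas f -> (integ m f)%:E = (\int[m]_x (f x)%:E)%E.
Proof.
move=> bf; rewrite /integ /Rintegral fineK//.
by apply: integrable_fin_num => //; exact: bmeas_intf.
Qed.

Lemma bmeas_integ m F : bmeas F -> bmeas (fun x => integ m (fun y => F (x, y))).
Proof.
move=> bF; split.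
  rewrite (_ : (fun x => _) = fine \o fubini_F m (EFin \o F))//.
  apply: (measurableT_comp (fine_measurable measurableT)).
  exact: measurable_fubini_F (integrable_prod m m bF).
have [_ [C FC]] := bF; have [_ _ [D mD]] := integ_bounded_linear m.
by exists (D * C) => x; apply: mD => //; exact: bmeas_pair1.
Qed.

Lemma integ_swap m1 m2 F : bmeas F ->
  integ m1 (fun x => integ m2 (fun y => F (x, y))) =
  integ m2 (fun y => integ m1 (fun x => F (x, y))).
Proof.
move=> bF; apply: EFin_inj; rewrite !integ_EFin.
- under eq_integral do rewrite (integ_EFin _ (bmeas_pair1 _ bF)).
  under [RHS]eq_integral do rewrite (integ_EFin _ (bmeas_pair2 _ bF)).
  exact: Fubini (integrable_prod m1 m2 bF).
- exact: (bmeas_integ m1 (bmeas_swap bF)).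
- exact: bmeas_integ.
Qed.

Lemma bmeas_cint V F : bmeas F -> bmeas (fun x => cint V (fun y => F (x, y))).
Proof. by move=> bF; apply: bmeasB; exact: bmeas_integ. Qed.

Lemma cint_swap V W F : bmeas F ->
  cint V (fun x => cint W (fun y => F (x, y))) =
  cint W (fun y => cint V (fun x => F (x, y))).
Proof.
move=> bF; rewrite /cint.
have integB m f g : bmeas f -> bmeas g ->
    integ m (fun x => f x - g x) = integ m f - integ m g.
  move=> bf bg; rewrite /integ RintegralB//; exact: bmeas_intf.
have b1 := bmeas_integ _ bF; have b2 := bmeas_integ _ (bmeas_swap bF).
rewrite !integB; try exact: b1; try exact: b2.
rewrite (integ_swap (charge_pos V) (charge_pos W) bF).
rewrite (integ_swap (charge_pos V) (charge_neg W) bF).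
rewrite (integ_swap (charge_neg V) (charge_pos W) bF).
rewrite (integ_swap (charge_neg V) (charge_neg W) bF).
ring.
Qed.
End fubini_charge.

Section convolution_functional.
Context d (T : measurableZmodType d) (R : realType).
Local Notation M := (charge T R).
Implicit Types (V W : M) (f : T -> R).

Lemma bmeas_add f : bmeas f -> bmeas (fun p : T * T => f (p.2 + p.1)).
Proof.
move=> [mf [C fC]]; split; last by exists C.
exact: (measurableT_comp mf (@measurable_addp d T)).
Qed.

Lemma bmeas_translate f (x : T) : bmeas f -> bmeas (fun y : T => f (y + x)).
Proof. by move=> bf; exact: (bmeas_pair1 x (bmeas_add bf)). Qed.

Lemma bmeas_cint_translate V f : bmeas f -> bmeas (fun x : T => cint V (fun y : T => f (y + x))).
Proof. by move=> bf; exact: (bmeas_cint V (bmeas_add bf)). Qed.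

(** Both sides are bounded linear in [f], and at indicators this is the
    definition of the convolution. *)
Lemma cint_sconv V W f : bmeas f ->
  cint (sconv V W) f = cint W (fun x : T => cint V (fun y : T => f (y + x))).
Proof.
move=> bf; symmetry; move: f bf; apply: cint_unique.
  split.
  - move=> f g bf bg; rewrite -cintD; [|exact: bmeas_cint_translate..].
    congr cint; apply/funext => x; rewrite -cintD//; exact: bmeas_translate.
  - move=> c f bf; rewrite -cintZ; last exact: bmeas_cint_translate.
    congr cint; apply/funext => x; rewrite -cintZ//; exact: bmeas_translate.
  - exists (tvnorm W * tvnorm V) => f C bf fC.
    rewrite (_ : _ * C = C * tvnorm V * tvnorm W); last by ring.
    apply: cint_le_tvnorm; first exact: bmeas_cint_translate.
    by move=> x; apply: cint_le_tvnorm => //; exact: bmeas_translate.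
move=> A mA; rewrite /sconv/= /cconv /charge_integral.
have bV : bmeas (fun x : T => fine (V (subset_sub A x))).
  rewrite (_ : (fun _ => _) = fun x : T => cint V (fun y : T => \1_A (y + x))).
    exact/bmeas_cint_translate/bmeas_indic.
  apply/funext => x; rewrite -cint_indic; last exact: measurable_subset_sub.
  by congr cint; apply/funext => y; rewrite !indicE subset_subE; congr (nat_of_bool _)%:R.
rewrite (_ : (fun x : T => cint V _) = fun x : T => fine (V (subset_sub A x))); last first.
  apply/funext => x; rewrite -cint_indic; last exact: measurable_subset_sub.
  by congr cint; apply/funext => y; rewrite !indicE subset_subE; congr (nat_of_bool _)%:R.
rewrite /cint /integ /Rintegral -fineB; last 2 first.
- by apply: integrable_fin_num => //; exact: bmeas_intf.
- by apply: integrable_fin_num => //; exact: bmeas_intf.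
congr (fine (_ - _)); apply: eq_integral => x _; rewrite fineK// fin_num_measure//;
  exact: measurable_subset_sub.
Qed.

End convolution_functional.

(** * The convolution algebra *)

(** A signed measure modulo equality on measurable sets is represented by its
    integration functional; the value 0 outside the bounded measurable functions
    makes the representation unique, so that equality is Leibniz equality. *)
Section smeas.
Context d (T : measurableZmodType d) (R : realType).
Local Notation M := (charge T R).
Implicit Types (V W : M) (f : T -> R).

Definition smeas := {L : (T -> R) -> R |
  exists V : M, L = (fun f => if `[< bmeas f >] then cint V f else 0)}.

HB.instance Definition _ := gen_eqMixin smeas.
HB.instance Definition _ := gen_choiceMixin smeas.

Definition smeas_of V : smeas :=
  exist _ (fun f => if `[< bmeas f >] then cint V f else 0) (ex_intro _ V erefl).

Definition charge_repr (a : smeas) : M := sval (cid (svalP a)).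

Definition act (a : smeas) f : R := cint (charge_repr a) f.

Lemma charge_reprP a : sval a = (fun f => if `[< bmeas f >] then act a f else 0).
Proof. exact: (svalP (cid (svalP a))). Qed.

Lemma act_smeas_of V f : bmeas f -> act (smeas_of V) f = cint V f.
Proof.
move=> bf; rewrite /act /charge_repr; case: cid => W /= /(congr1 (fun L => L f)).
by rewrite asboolT.
Qed.

Lemma smeas_ext (a b : smeas) : (forall f, bmeas f -> act a f = act b f) -> a = b.
Proof.
move=> ab; apply: eq_sig_hprop; first by move=> L; exact: Prop_irrelevance.
rewrite !charge_reprP; apply/funext => f.
by case: asboolP => // bf; exact: ab.
Qed.

Let add_subproof : {add : smeas -> smeas -> smeas | forall a b f, bmeas f ->
  act (add a b) f = act a f + act b f}.
Proof.
exists (fun a b => smeas_of (cadd (charge_repr a) (charge_repr b))) => a b f bf.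
by rewrite act_smeas_of// cint_saddm.
Qed.
Let add := sval add_subproof.
Let opp a := smeas_of (copp (charge_repr a)).
Let zero := smeas_of (@szero d T R).
Let scale_subproof : {scale : R -> smeas -> smeas | forall c a f, bmeas f ->
  act (scale c a) f = c * act a f}.
Proof.
exists (fun c a => smeas_of (cscale c (charge_repr a))) => c a f bf.
by rewrite act_smeas_of// cint_cscale.
Qed.
Let scale := sval scale_subproof.
Let mul_subproof : {mul : smeas -> smeas -> smeas | forall a b f, bmeas f ->
  act (mul a b) f = act b (fun x : T => act a (fun y : T => f (y + x)))}.
Proof.
exists (fun a b => smeas_of (sconv (charge_repr a) (charge_repr b))) => a b f bf.
by rewrite act_smeas_of// cint_sconv.
Qed.
Let mul := sval mul_subproof.
Let one := smeas_of (@sdirac0 d T R).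

Let act_add a b f : bmeas f -> act (add a b) f = act a f + act b f.
Proof. exact: (svalP add_subproof). Qed.

Let act_opp a f : bmeas f -> act (opp a) f = - act a f.
Proof. by move=> bf; rewrite act_smeas_of// cint_copp. Qed.

Let act_zero f : bmeas f -> act zero f = 0.
Proof. by move=> bf; rewrite act_smeas_of// cint_czero. Qed.

Let act_scale c a f : bmeas f -> act (scale c a) f = c * act a f.
Proof. exact: (svalP scale_subproof). Qed.

Let act_mul a b f : bmeas f ->
  act (mul a b) f = act b (fun x : T => act a (fun y : T => f (y + x))).
Proof. exact: (svalP mul_subproof). Qed.

Let act_one f : bmeas f -> act one f = f 0.
Proof.
move=> bf; rewrite act_smeas_of// cint_measure// /integ /Rintegral.
rewrite integral_dirac//; first by rewrite diracT mul1e.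
by apply/measurable_EFinP; case: bf.
Qed.

Let addA : associative add.
Proof. by move=> a b c; apply: smeas_ext => f bf; rewrite !act_add// addrA. Qed.
Let addC : commutative add.
Proof. by move=> a b; apply: smeas_ext => f bf; rewrite !act_add// addrC. Qed.
Let add0 : left_id zero add.
Proof. by move=> a; apply: smeas_ext => f bf; rewrite act_add// act_zero// add0r. Qed.
Let addN : left_inverse zero opp add.
Proof.
by move=> a; apply: smeas_ext => f bf; rewrite act_add// act_zero// act_opp// addNr.
Qed.

HB.instance Definition _ := GRing.isZmodule.Build smeas addA addC add0 addN.

Let b_tr a f : bmeas f -> bmeas (fun x : T => act a (fun y : T => f (y + x))).
Proof. exact: bmeas_cint_translate. Qed.

Let mulA : associative mul.
Proof.
move=> a b c; apply: smeas_ext => f bf.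
rewrite (act_mul a (mul b c) bf) (act_mul b c (b_tr a bf)) (act_mul (mul a b) c bf).
congr (act c _); apply/funext => z.
rewrite (act_mul a b (bmeas_translate z bf)).
congr (act b _); apply/funext => x; congr (act a _); apply/funext => y.
by rewrite addrA.
Qed.
Let mulC : commutative mul.
Proof.
move=> a b; apply: smeas_ext => f bf; rewrite (act_mul a b bf) (act_mul b a bf).
rewrite /act (cint_swap _ _ (bmeas_add bf)).
by congr cint; apply/funext => y; congr cint; apply/funext => x; rewrite addrC.
Qed.
Let mul1 : left_id one mul.
Proof.
move=> a; apply: smeas_ext => f bf; rewrite (act_mul one a bf); congr (act a _).
by apply/funext => x; rewrite (act_one (bmeas_translate x bf)) add0r.
Qed.
Let mulD : left_distributive mul (@GRing.add smeas).
Proof.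
move=> a b c; apply: smeas_ext => f bf; rewrite (act_mul (a + b) c bf) (act_add (mul a c) (mul b c) bf).
rewrite (act_mul a c bf) (act_mul b c bf) /act -cintD; [|exact: b_tr..].
by congr cint; apply/funext => x; exact: (act_add a b (bmeas_translate x bf)).
Qed.
Let one0 : one != 0.
Proof.
apply/eqP => /(congr1 (act ^~ (fun=> 1))); rewrite act_one; last exact: bmeas_cst.
by rewrite act_zero; [move/eqP; rewrite oner_eq0|exact: bmeas_cst].
Qed.

HB.instance Definition _ := GRing.Zmodule_isComNzRing.Build smeas mulA mulC mul1 mulD one0.

Let scaleA a b v : scale a (scale b v) = scale (a * b) v.
Proof. by apply: smeas_ext => f bf; rewrite !act_scale// mulrA. Qed.
Let scale1 : left_id 1 scale.
Proof. by move=> a; apply: smeas_ext => f bf; rewrite act_scale// mul1r. Qed.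
Let scaleDr : right_distributive scale +%R.
Proof.
by move=> c a b; apply: smeas_ext => f bf; rewrite act_scale// !act_add// !act_scale// mulrDr.
Qed.
Let scaleDl v : {morph scale^~ v : a b / a + b}.
Proof.
by move=> a b; apply: smeas_ext => f bf; rewrite act_scale// act_add// !act_scale// mulrDl.
Qed.

HB.instance Definition _ := GRing.Zmodule_isLmodule.Build R smeas scaleA scale1 scaleDr scaleDl.

Let scaleAl (c : R) (a b : smeas) : c *: (a * b) = (c *: a) * b.
Proof.
apply: smeas_ext => f bf; rewrite (act_scale c (a * b) bf) (act_mul a b bf) (act_mul (c *: a) b bf).
rewrite /act -cintZ; last exact: b_tr.
by congr cint; apply/funext => x; exact/esym/(act_scale c a (bmeas_translate x bf)).
Qed.
HB.instance Definition _ := GRing.Lmodule_isLalgebra.Build R smeas scaleAl.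
HB.instance Definition _ := GRing.Lalgebra_isComAlgebra.Build R smeas.

Lemma actD (a b : smeas) f : bmeas f -> act (a + b) f = act a f + act b f.
Proof. exact: act_add. Qed.

Lemma actN (a : smeas) f : bmeas f -> act (- a) f = - act a f.
Proof. exact: act_opp. Qed.

Lemma act0 f : bmeas f -> act 0 f = 0.
Proof. exact: act_zero. Qed.

Lemma actM (a b : smeas) f : bmeas f ->
  act (a * b) f = act b (fun x : T => act a (fun y : T => f (y + x))).
Proof. exact: act_mul. Qed.

Lemma act1 f : bmeas f -> act 1 f = f 0.
Proof. exact: act_one. Qed.

Lemma actZ c (a : smeas) f : bmeas f -> act (c *: a) f = c * act a f.
Proof. exact: act_scale. Qed.

Lemma bmeas_act_translate (a : smeas) f : bmeas f ->
  bmeas (fun x : T => act a (fun y : T => f (y + x))).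
Proof. exact: b_tr. Qed.

Lemma smeas_of_saddm V W : smeas_of (saddm V W) = smeas_of V + smeas_of W.
Proof.
by apply: smeas_ext => f bf; rewrite actD// !act_smeas_of// cint_saddm.
Qed.

Lemma smeas_of_ssubm V W : smeas_of (ssubm V W) = smeas_of V - smeas_of W.
Proof.
by apply: smeas_ext => f bf; rewrite actD// actN// !act_smeas_of// cint_ssubm.
Qed.

Lemma smeas_of_szero : smeas_of (@szero d T R) = 0.
Proof. by apply: smeas_ext => f bf; rewrite act0// act_smeas_of// cint_czero. Qed.

Lemma smeas_of_cscale c V : smeas_of (cscale c V) = c *: smeas_of V.
Proof.
by apply: smeas_ext => f bf; rewrite actZ// !act_smeas_of// cint_cscale.
Qed.

Lemma smeas_of_sdirac0 : smeas_of (@sdirac0 d T R) = 1.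
Proof. by []. Qed.

Lemma smeas_of_sconv V W : smeas_of (sconv V W) = smeas_of V * smeas_of W.
Proof.
apply: smeas_ext => f bf.
rewrite (act_smeas_of _ bf) (cint_sconv V W bf) (actM _ _ bf).
have -> : (fun x : T => act (smeas_of V) (fun y : T => f (y + x))) =
    (fun x : T => cint V (fun y : T => f (y + x))).
  by apply/funext => x; rewrite act_smeas_of//; exact: bmeas_translate.
by rewrite act_smeas_of//; exact: bmeas_cint_translate.
Qed.

Lemma smeas_of_sconv_exp V k : smeas_of (sconv_exp V k) = smeas_of V ^+ k.
Proof.
elim: k => [|k IH]; first exact: smeas_of_sdirac0.
by rewrite exprS -IH -smeas_of_sconv.
Qed.

Definition tv (a : smeas) : R := tvnorm (charge_repr a).

Lemma tv_smeas_of V : tv (smeas_of V) = tvnorm V.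
Proof. by apply: eq_tvnorm => f bf; exact: act_smeas_of. Qed.

Lemma tv_ge0 a : 0 <= tv a.
Proof. exact: tvnorm_ge0. Qed.

Lemma act_le_tv a f C : bmeas f -> (forall x, `|f x| <= C) -> `|act a f| <= C * tv a.
Proof. exact: cint_le_tvnorm. Qed.

Lemma tv_le a C : (forall u, bmeas u -> (forall x, `|u x| <= 1) -> act a u <= C) ->
  tv a <= C.
Proof. exact: tvnorm_le. Qed.

Lemma tvD a b : tv (a + b) <= tv a + tv b.
Proof.
apply: tv_le => u bu u1; rewrite actD// -[tv a]mul1r -[tv b]mul1r.
by rewrite lerD// (le_trans (ler_norm _))// act_le_tv.
Qed.

Lemma tvM a b : tv (a * b) <= tv a * tv b.
Proof.
apply: tv_le => u bu u1; rewrite (actM a b bu); apply: le_trans (ler_norm _) _.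
apply: act_le_tv; first exact: bmeas_act_translate.
by move=> x; rewrite -[tv a]mul1r; apply: act_le_tv => //; exact: bmeas_translate.
Qed.

Lemma tvZ c a : tv (c *: a) = `|c| * tv a.
Proof.
have H c' a' : tv (c' *: a') <= `|c'| * tv a'.
  apply: tv_le => u bu u1; rewrite actZ//; apply: le_trans (ler_norm _) _.
  by rewrite normrM ler_wpM2l// -[tv a']mul1r act_le_tv.
apply/le_anti/andP; split; first exact: H.
have [->|c0] := eqVneq c 0; first by rewrite normr0 mul0r tv_ge0.
rewrite -{1}(scalerK c0 a) -ler_pdivlMl ?normr_gt0// -normfV; exact: H.
Qed.

Lemma tv1 : tv 1 <= 1.
Proof. by apply: tv_le => u bu u1; rewrite act1// (le_trans (ler_norm _)). Qed.

Lemma tv_scharge (P : probability T R) : tv (smeas_of (scharge P)) <= 1.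
Proof.
apply: tv_le => u bu u1; rewrite act_smeas_of// cint_measure//.
apply: (@le_trans _ _ (\int[P]_x 1)).
  apply: le_Rintegral => //; [exact: bmeas_intf|exact/bmeas_intf/bmeas_cst|].
  by move=> x _; apply: le_trans (ler_norm _) (u1 x).
by rewrite Rintegral_cst// mul1r [fine _](_ : _ = fine 1%E)// -(@probability_setT _ _ _ P).
Qed.
End smeas.

(** * Variance contraction under convolution powers *)

Section translation_average.
Context d (T : measurableZmodType d) (R : realType).
Implicit Types (a b g : smeas T R) (f u : T -> R).

(** For a probability [a] this is the conditional expectation [E u(X + x)], with
    [X] of law [a]. *)
Definition avg a u : T -> R := fun x : T => act a (fun y : T => u (y + x)).

Lemma bmeas_avg a u : bmeas u -> bmeas (avg a u).
Proof. exact: bmeas_act_translate. Qed.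

Lemma act_addf a f u : bmeas f -> bmeas u ->
  act a (fun x => f x + u x) = act a f + act a u.
Proof. exact: cintD. Qed.

Lemma act_scalef a c f : bmeas f -> act a (fun x => c * f x) = c * act a f.
Proof. exact: cintZ. Qed.

Lemma act_subf a f u : bmeas f -> bmeas u ->
  act a (fun x => f x - u x) = act a f - act a u.
Proof.
move=> bf bu; rewrite -[- act a u]mulN1r -act_scalef// -act_addf//; last exact: bmeasZ.
by congr (act a _); apply/funext => x; rewrite mulN1r.
Qed.

Lemma avgM a b u : bmeas u -> avg (a * b) u = avg b (avg a u).
Proof.
move=> bu; apply/funext => x; rewrite /avg (actM a b (bmeas_translate x bu)).
congr (act b _); apply/funext => z; congr (act a _); apply/funext => y.
by rewrite addrA.
Qed.

Lemma avg1 u : bmeas u -> avg 1 u = u.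
Proof.
by move=> bu; apply/funext => x; rewrite /avg (act1 (bmeas_translate x bu)) add0r.
Qed.

Definition isprob a := (forall f, bmeas f -> (forall x, 0 <= f x) -> 0 <= act a f) /\
  act a (fun=> 1) = 1.

Lemma isprob1 : isprob 1.
Proof. by split=> [f bf f0|]; rewrite act1//; exact: bmeas_cst. Qed.

Lemma isprobM a b : isprob a -> isprob b -> isprob (a * b).
Proof.
move=> [a0 a1] [b0 b1]; split=> [f bf f0|].
  rewrite (actM a b bf); apply: b0; first exact: bmeas_avg.
  by move=> x; apply: a0 => //; exact: bmeas_translate.
by rewrite (actM a b (bmeas_cst _ 1)) -[RHS]b1; congr (act b _); apply/funext => x.
Qed.

Lemma isprobX a n : isprob a -> isprob (a ^+ n).
Proof.
move=> pa; elim: n => [|n IH]; first by rewrite expr0; exact: isprob1.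
by rewrite exprS; exact: isprobM.
Qed.

Lemma isprob_scharge (P : probability T R) : isprob (smeas_of (scharge P)).
Proof.
split=> [f bf f0|]; rewrite act_smeas_of ?cint_measure//; try exact: bmeas_cst.
  by apply: Rintegral_ge0.
by rewrite /integ Rintegral_cst// mul1r [fine _](_ : _ = fine 1%E)// -(@probability_setT _ _ _ P).
Qed.

Lemma act_cst a c : isprob a -> act a (fun=> c) = c.
Proof.
move=> [_ a1]; rewrite -[RHS]mulr1 -a1 -act_scalef; last exact: bmeas_cst.
by congr (act a _); apply/funext => x; rewrite mulr1.
Qed.

Definition variance a u := act a (fun x => u x ^+ 2) - act a u ^+ 2.

Lemma bmeas_sqr u : bmeas u -> bmeas (fun x => u x ^+ 2).
Proof. by move=> bu; exact: bmeasM. Qed.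

Lemma variance_centered a u : isprob a -> bmeas u ->
  act a (fun x => (u x - act a u) ^+ 2) = variance a u.
Proof.
move=> pa bu; set c := act a u.
have -> : (fun x => (u x - c) ^+ 2) =
    (fun x => (u x ^+ 2 - (2 * c) * u x) + c ^+ 2).
  by apply/funext => x; ring.
rewrite act_addf; [|exact: bmeasB (bmeas_sqr bu) (bmeasZ _ bu)|exact: bmeas_cst].
rewrite act_subf; [|exact: bmeas_sqr|exact: bmeasZ].
by rewrite act_scalef// act_cst// /variance -/c; ring.
Qed.

Lemma variance_ge0 a u : isprob a -> bmeas u -> 0 <= variance a u.
Proof.
move=> pa bu; rewrite -variance_centered//; apply: pa.1 => [|x]; last exact: sqr_ge0.
by apply/bmeas_sqr/bmeasB => //; exact: bmeas_cst.
Qed.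

Lemma bmeas_variance a u : bmeas u ->
  bmeas (fun x : T => variance a (fun y : T => u (y + x))).
Proof.
move=> bu; apply: bmeasB; first exact: (bmeas_avg a (bmeas_sqr bu)).
exact/bmeas_sqr/bmeas_avg.
Qed.

(** Jensen's inequality for the variance: integrate over [x] the variance of
    the difference between the translate [y |-> u (y + x)] and the average
    [avg b u]. The mean of the covariance of the two is the variance of
    [avg b u], by Fubini's theorem. *)
Lemma variance_avg_le a b u : isprob a -> isprob b -> bmeas u ->
  variance a (avg b u) <= act b (fun x : T => variance a (fun y : T => u (y + x))).
Proof.
move=> pa pb bu; pose e := avg b u.
have be : bmeas e by exact: bmeas_avg.
have bux x : bmeas (fun y : T => u (y + x)) by exact: bmeas_translate.
have bF : bmeas (fun p : T * T => u (p.2 + p.1) * e p.2).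
  apply: bmeasM; first exact: bmeas_add.
  have [me [C eC]] := be; split; last by exists C.
  exact: measurableT_comp me measurable_snd.
(* The covariance of the translate by x and of e is cross x - act a e * avg a u x. *)
pose cross := fun x : T => act a (fun y : T => u (y + x) * e y).
have bcross : bmeas cross by exact: (bmeas_cint (charge_repr a) bF).
have bav : bmeas (avg a u) by exact: bmeas_avg.
have cross_mean : act b cross = act a (fun y => e y ^+ 2).
  rewrite /act /cross /act (cint_swap _ _ bF) /=; congr cint; apply/funext => y.
  rewrite -/(act b _) expr2 -[X in _ = X * _]/(act b (fun x : T => u (x + y))).
  rewrite mulrC -act_scalef; last exact: bmeas_translate.
  by congr (act b _); apply/funext => x; rewrite mulrC addrC.
have avg_mean : act b (avg a u) = act a e.
  rewrite /act /avg /act (cint_swap _ _ (bmeas_add bu)) /=; congr cint; apply/funext => y.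
  by congr cint; apply/funext => x; rewrite addrC.
have key x : 0 <= variance a (fun y : T => u (y + x)) -
    (2 * (cross x - act a e * avg a u x) - variance a e).
  have -> : variance a (fun y : T => u (y + x)) -
      (2 * (cross x - act a e * avg a u x) - variance a e) =
      variance a (fun y : T => u (y + x) - e y).
    rewrite /variance (act_subf a (bux x) be).
    have -> : (fun y : T => (u (y + x) - e y) ^+ 2) =
        (fun y : T => (u (y + x) ^+ 2 - 2 * (u (y + x) * e y)) + e y ^+ 2).
      by apply/funext => y; ring.
    have b1 := bmeasM (bux x) be.
    have b2 := bmeasB (bmeas_sqr (bux x)) (bmeasZ 2 b1).
    rewrite (act_addf a b2 (bmeas_sqr be)).
    rewrite (act_subf a (bmeas_sqr (bux x)) (bmeasZ 2 b1)) (act_scalef a 2 b1).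
    by rewrite /cross /avg; ring.
  by apply: variance_ge0 => //; exact: bmeasB.
have b1 := bmeas_variance a bu.
have b2 : bmeas (fun x => act a e * avg a u x) by exact: bmeasZ.
have b3 : bmeas (fun x => 2 * (cross x - act a e * avg a u x)) by exact/bmeasZ/bmeasB.
have b4 := @bmeas_cst _ T R (variance a e).
have := pb.1 _ (bmeasB b1 (bmeasB b3 b4)) key.
rewrite (act_subf b b1 (bmeasB b3 b4)) (act_subf b b3 b4) (act_scalef b 2 (bmeasB bcross b2)).
rewrite (act_subf b bcross b2) (act_scalef b _ bav) cross_mean avg_mean act_cst//.
rewrite -/e /variance.
by move: (act b _) (act a (fun y => e y ^+ 2)) (act a e) => X Y Z; lra.
Qed.

(** If [S] is a sum of independent variables of law [g] and [X] is one of them,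
    the variance of [u(S)] is the mean of its conditional variance given
    [S - X] plus the variance of [E(u(S) | S - X)]. The former is at least the
    variance of [E(u(S) | X)] by [variance_avg_le], and the latter is treated by
    induction. *)
Lemma variance_smoothing g m u : isprob g -> bmeas u ->
  m.+1%:R * variance g (avg (g ^+ m) u) <= variance (g ^+ m.+1) u.
Proof.
move=> pg; elim: m u => [|m IH] u bu.
  by rewrite expr0 expr1 mul1r avg1.
have bgu : bmeas (avg g u) by exact: bmeas_avg.
have := IH _ bgu; rewrite -(avgM g (g ^+ m) bu) -exprS => {}IH.
have E : variance (g ^+ m.+2) u =
    act (g ^+ m.+1) (fun x : T => variance g (fun y : T => u (y + x))) +
    variance (g ^+ m.+1) (avg g u).
  rewrite {1}/variance exprS (actM _ _ (bmeas_sqr bu)) (actM _ _ bu).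
  (* The law of total variance: the two terms act _ (avg g u) ^+ 2 cancel. *)
  have := act_subf (g ^+ m.+1) (bmeas_avg g (bmeas_sqr bu)) (bmeas_sqr bgu).
  rewrite /variance -/(avg g (fun x => u x ^+ 2)) -/(avg g u) => ->.
  by move: (act _ _) (act _ (avg g u)) (act _ _) => X Y Z; ring.
rewrite E -natr1 mulrDl mul1r addrC lerD// variance_avg_le//; exact: isprobX.
Qed.
End translation_average.

(** * Smoothing of a density by a convolution power *)

Section density.
Context d (T : measurableType d) (R : realType).
Variable (G : probability T R).
Implicit Types (h u : T -> R) (V : charge T R).

Lemma integrableM_bmeas h u : G.-integrable setT (EFin \o h) -> bmeas u ->
  G.-integrable setT (EFin \o (fun x => h x * u x)).
Proof.
move=> ih [mu [C uC]].
rewrite (_ : _ \o _ = (EFin \o h) \* (EFin \o u))%E.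
  apply: integrableMl => //; exists C; split; first exact: num_real.
  by move=> y Cy x _; apply: le_trans (uC x) (ltW Cy).
by apply/funext => x /=; rewrite EFinM.
Qed.

(** Both sides are bounded linear in [u], and they agree at indicators by
    assumption. *)
Lemma cint_density V h : G.-integrable setT (EFin \o h) ->
  (forall A, measurable A -> V A = (\int[G]_(x in A) (h x)%:E)%E) ->
  forall u, bmeas u -> cint V u = \int[G]_x (h x * u x).
Proof.
move=> ih Vh u bu; symmetry; move: u bu; apply: cint_unique.
  split.
  - move=> f g bf bg; rewrite -RintegralD//; try exact: integrableM_bmeas.
    by apply: eq_Rintegral => x _; rewrite mulrDr.
  - move=> c f bf; rewrite -RintegralZl//; try exact: integrableM_bmeas.
    by apply: eq_Rintegral => x _; rewrite mulrCA.
  - exists (\int[G]_x `|h x|) => f C bf fC.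
    apply: le_trans (le_normr_Rintegral _ (integrableM_bmeas ih bf)) _ => //.
    rewrite -RintegralZr//; last exact: integrable_norm.
    apply: le_Rintegral => //; [exact: (integrable_norm (integrableM_bmeas ih bf))| |].
      have := integrable_norm ih; move/(integrableZr measurableT C).
      by apply: eq_integrable.
    by move=> x _; rewrite normrM ler_wpM2l.
move=> A mA; rewrite Vh// /Rintegral [in RHS]integral_mkcond; congr fine.
apply: eq_integral => x _; rewrite patchE indicE; case: (x \in A);
  by rewrite ?mulr1 ?mulr0.
Qed.

(** The integral of [(h - t u)^2] is nonnegative; take [t = int h u / b]. *)
Lemma Rintegral_cauchy_schwarz h u b : G.-integrable setT (EFin \o h) ->
  G.-integrable setT (EFin \o (fun x => h x ^+ 2)) -> bmeas u ->
  \int[G]_x (u x ^+ 2) <= b -> 0 < b ->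
  (\int[G]_x (h x * u x)) ^+ 2 <= (\int[G]_x (h x ^+ 2)) * b.
Proof.
move=> ih ih2 bu ub b0.
set C := \int[G]_x (h x * u x); set A := \int[G]_x (h x ^+ 2).
pose t := C / b.
have bu2 : bmeas (fun x => u x ^+ 2) by exact: bmeasM.
have i1 := integrableM_bmeas ih bu.
have : 0 <= \int[G]_x ((h x ^+ 2 - (2 * t) * (h x * u x)) + t ^+ 2 * u x ^+ 2).
  apply: Rintegral_ge0 => x _.
  rewrite (_ : _ + _ = (h x - t * u x) ^+ 2) ?sqr_ge0//; ring.
have i2 : G.-integrable setT (EFin \o (fun x => (2 * t) * (h x * u x))).
  exact: (integrableZl measurableT (2 * t) i1).
have i3 : G.-integrable setT (EFin \o (fun x => t ^+ 2 * u x ^+ 2)).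
  exact/bmeas_intf/bmeasZ.
have i4 : G.-integrable setT (EFin \o (fun x => h x ^+ 2 - (2 * t) * (h x * u x))).
  exact: (integrableB measurableT ih2 i2).
rewrite RintegralD// RintegralB// RintegralZl// RintegralZl//; last exact: bmeas_intf.
rewrite -/C -/A => H.
have {}H : 0 <= A - 2 * t * C + t ^+ 2 * b.
  by apply: le_trans H _; rewrite lerD2l ler_wpM2l// sqr_ge0.
rewrite -ler_pdivrMr// -subr_ge0; move: H.
rewrite (_ : A - 2 * t * C + t ^+ 2 * b = A - C ^+ 2 / b)//.
by rewrite /t; field; rewrite gt_eqF.
Qed.
End density.

Section smoothing.
Context d (T : measurableZmodType d) (R : realType) (G : probability T R).
Local Notation g := (smeas_of (scharge G)).
Implicit Types (h f u : T -> R) (V : charge T R).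

Lemma act_probability u : bmeas u -> act g u = \int[G]_x u x.
Proof. by move=> bu; rewrite act_smeas_of// cint_measure. Qed.

Lemma tv_probX q : tv (g ^+ q) <= 1.
Proof.
apply: le_trans (seminorm_exp (@tvM _ _ _) (@tv1 _ _ _) (@tv_ge0 _ _ _) _ _) _.
by rewrite exprn_ile1 ?tv_ge0 ?tv_scharge.
Qed.

(** For a test function [u], the left side is the integral of [h e], with
    [e = avg (g ^+ q) u]. The mean [c] of [e] contributes [c] times the total mass,
    and [e - c] has variance at most [1 / (q+1)]. *)
Lemma tv_density_smoothing_le V h q : G.-integrable setT (EFin \o h) ->
  (forall A, measurable A -> V A = (\int[G]_(x in A) (h x)%:E)%E) ->
  G.-integrable setT (EFin \o (fun x => h x ^+ 2)) ->
  tv (smeas_of V * g ^+ q) <=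
  `|fine (V setT)| + Num.sqrt (\int[G]_x (h x ^+ 2) / q.+1%:R).
Proof.
move=> ih Vh ih2; apply: tv_le => u bu u1.
have pg := isprob_scharge G.
pose e := avg (g ^+ q) u; have be : bmeas e by exact: bmeas_avg.
have e1 x : `|e x| <= 1.
  rewrite /e /avg; apply: le_trans (act_le_tv _ (bmeas_translate x bu) (fun y => u1 _)) _.
  by rewrite mul1r tv_probX.
pose c := act g e.
have cle1 : `|c| <= 1.
  by apply: le_trans (act_le_tv _ be e1) _; rewrite mul1r tv_scharge.
have q0 : (0 : R) < q.+1%:R by rewrite ltr0n.
have bc := @bmeas_cst _ T R c.
have bec := bmeasB be bc.
rewrite mulrC (actM _ _ bu) -/e -/(avg _ u) -/e act_smeas_of// (cint_density ih Vh be).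
have -> : \int[G]_x (h x * e x) =
    c * fine (V setT) + \int[G]_x (h x * (e x - c)).
  rewrite Vh// -/(Rintegral G setT h) -RintegralZl// -RintegralD//.
  - by apply: eq_Rintegral => x _; ring.
  - exact: (integrableZl measurableT c ih).
  - exact: integrableM_bmeas.
apply: lerD.
  by apply: le_trans (ler_norm _) _; rewrite normrM ler_piMl.
apply: le_trans (ler_norm _) _; rewrite -sqrtr_sqr.
apply: ler_wsqrtr; apply: (Rintegral_cauchy_schwarz ih ih2 bec); last first.
  by rewrite invr_gt0.
rewrite -act_probability; last exact: bmeas_sqr.
rewrite variance_centered// -[leRHS]mul1r ler_pdivlMr// mulrC.
apply: le_trans (variance_smoothing _ pg bu) _.
rewrite /variance lerBlDr; apply: (@le_trans _ _ 1); last by rewrite lerDl sqr_ge0.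
rewrite -(act_cst 1 (isprobX q.+1 pg)) -subr_ge0.
rewrite -(act_subf _ (bmeas_cst _ 1) (bmeas_sqr bu)).
apply: (isprobX q.+1 pg).1; first exact: bmeasB (bmeas_cst _ 1) (bmeas_sqr bu).
by move=> x; rewrite subr_ge0 -[leRHS](expr1n _ 2) -real_normK ?num_real// lerXn2r ?nnegrE.
Qed.

(** On the complement of [B], the difference has the density [f - 1], and its
    mass there is the opposite of its mass on [B]. *)
Lemma tv_smoothing_le V (B : set T) (mB : measurable B) f q :
  V setT = 1%E ->
  is_density (crestr V (measurableC mB)) G f ->
  G.-integrable (~` B) (EFin \o (fun x => (f x - 1) ^+ 2)) ->
  tv ((smeas_of V - g) * g ^+ q) <=
  tvnorm (crestr (ssubm V (scharge G)) mB) + `|fine (ssubm V (scharge G) B)| +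
  Num.sqrt (\int[G]_(x in ~` B) ((f x - 1) ^+ 2) / q.+1%:R).
Proof.
move=> V1 [fi Vf] fi2; set D := ssubm V (scharge G).
have mBC := measurableC mB.
(* The density f vanishes almost everywhere on B, where f - 1 is therefore
   -1 and has to be cut off. *)
pose h := (fun x => f x - 1) \_ (~` B).
have i1 : G.-integrable setT (EFin \o (fun x => f x - 1)).
  exact: (integrableB measurableT fi (bmeas_intf G (bmeas_cst _ 1))).
have hi : G.-integrable setT (EFin \o h).
  rewrite /h -restrict_EFin; apply/integrable_restrict => //.
  by rewrite setTI; exact: integrableS i1.
have h2E : (fun x => h x ^+ 2) = (fun x => (f x - 1) ^+ 2) \_ (~` B).
  by apply/funext => x; rewrite /h !patchE; case: ifP => // _; rewrite expr0n.
have hi2 : G.-integrable setT (EFin \o (fun x => h x ^+ 2)).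
  rewrite h2E -restrict_EFin; apply/integrable_restrict => //.
  by rewrite setTI.
have Dh A : measurable A -> crestr D mBC A = (\int[G]_(x in A) (h x)%:E)%E.
  move=> mA; have mAB : measurable (A `&` ~` B) by exact: measurableI.
  have GE : G (A `&` ~` B) = (\int[G]_(x in A `&` ~` B) 1)%E.
    by rewrite integral_cst// mul1e.
  have VE : V (A `&` ~` B) = (\int[G]_(x in A `&` ~` B) (f x)%:E)%E.
    by rewrite -Vf//= /crestr -setIA setIid.
  rewrite /crestr/= /D /ssubm/= /cadd/= /copp/= /scharge/= /charge_of_finite_measure.
  rewrite VE GE -integralB//; last 2 first.
  - exact: integrableS fi.
  - exact: (integrableS measurableT mAB (@subsetT _ _) (bmeas_intf G (bmeas_cst _ 1))).
  rewrite integral_mkcondr; apply: eq_integral => x _.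
  by rewrite /h !patchE; case: ifP.
have -> : smeas_of V - g = smeas_of (crestr D mB) + smeas_of (crestr D mBC).
  rewrite -smeas_of_ssubm -smeas_of_saddm; apply: smeas_ext => u bu.
  rewrite !act_smeas_of//; apply: eq_cint => // A mA.
  rewrite /saddm/= /cadd/= /crestr -chargeU.
  - by rewrite -setIUr setUCr setIT.
  - exact: measurableI.
  - exact: measurableI.
  - by rewrite setIACA setICr setI0.
have DB : fine (crestr D mBC setT) = - fine (D B).
  have DT : D setT = 0%E.
    rewrite /D /ssubm/= /cadd/= /copp/= /scharge/= /charge_of_finite_measure.
    by rewrite V1 probability_setT subee.
  rewrite /crestr setTI -[~` B]setTD chargeD// DT setTI sub0e fineN//.
rewrite mulrDl; apply: le_trans (tvD _ _) _; rewrite -addrA; apply: lerD.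
  apply: le_trans (tvM _ _) _; rewrite tv_smeas_of ler_piMr ?tvnorm_ge0//.
  exact: tv_probX.
apply: le_trans (tv_density_smoothing_le q hi Dh hi2) _.
by rewrite DB normrN lerD2l h2E -Rintegral_mkcond.
Qed.
End smoothing.

(** * The approximation in the convolution algebra *)

Section approximation_in_algebra.
Context d (T : measurableZmodType d) (R : realType) (n : nat).
Variables (F : 'I_n -> probability T R) (G : probability T R).
Local Notation g := (smeas_of (scharge G)).
Local Notation f := (fun j => smeas_of (scharge (F j))).

Lemma smeas_of_sum (I : Type) (r : seq I) (P : pred I) (V : I -> charge T R) :
  smeas_of (\big[@saddm d T R/szero T R]_(i <- r | P i) V i) =
  \sum_(i <- r | P i) smeas_of (V i).
Proof. exact: (big_morph _ (@smeas_of_saddm d T R) (@smeas_of_szero d T R)). Qed.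

Lemma smeas_of_prod (I : Type) (r : seq I) (P : pred I) (V : I -> charge T R) :
  smeas_of (\big[@sconv d T R/sdirac0 T R]_(i <- r | P i) V i) =
  \prod_(i <- r | P i) smeas_of (V i).
Proof. exact: (big_morph _ (@smeas_of_sconv d T R) (@smeas_of_sdirac0 d T R)). Qed.

Lemma smeas_of_Fdiff j : smeas_of (Fdiff F G j) = f j - g.
Proof. exact: smeas_of_ssubm. Qed.

Lemma smeas_of_Mjk j k : smeas_of (Mjk F G j k) = (f j - g) * g ^+ ((n - k) %/ k).
Proof. by rewrite /Mjk smeas_of_sconv smeas_of_Fdiff smeas_of_sconv_exp. Qed.

Lemma smeas_of_Wl l : smeas_of (Wl F G l) =
  \sum_(0 <= k < l.+1) elem_sym k (fun j => f j - g) * g ^+ (n - k).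
Proof.
rewrite /Wl smeas_of_sum; apply: eq_bigr => k _.
rewrite smeas_of_sconv smeas_of_sconv_exp /Vk smeas_of_sum; congr (_ * _).
by apply: eq_bigr => J _; rewrite smeas_of_prod; apply: eq_bigr => j _; exact: smeas_of_Fdiff.
Qed.

Lemma nu_tv k : nu_ F G k 2 = \sum_j tv ((f j - g) * g ^+ ((n - k) %/ k)) ^+ 2.
Proof. by apply: eq_bigr => j _; rewrite -smeas_of_Mjk tv_smeas_of. Qed.

Lemma nu_tilde_tv k :
  nu_tilde F G k = tv (\sum_j (f j - g) * g ^+ ((n - k) %/ k)).
Proof.
rewrite /nu_tilde -tv_smeas_of smeas_of_sum; congr tv.
by apply: eq_bigr => j _; rewrite smeas_of_Mjk.
Qed.

Lemma eta_tv l (alpha : R) : eta F G l alpha = algebra_eta (@tv d T R) f g l alpha.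
Proof. by apply: eq_bigr => k _; rewrite nu_tv nu_tilde_tv. Qed.

Lemma tvnorm_prod_sub_le (alpha : R) l : 0 <= alpha -> (l <= n)%N ->
  let beta := `|Num.ceil (alpha * l.+1%:R / 2)|%N in
  eta F G l 0 < (2 * expR 1 * c1 R)^-1 ->
  tvnorm (ssubm (Fprod F) (Wl F G l)) <=
    l.+1%:R ^+ beta * beta`!%:R *
    ((2 * expR 1 * c1 R * eta F G l alpha) `^ (l.+1%:R / 2) /
     (1 - Num.sqrt (2 * expR 1 * c1 R * eta F G l 0)) ^+ beta.+1).
Proof.
move=> alpha0 ln beta eta_lt; rewrite -tv_smeas_of smeas_of_ssubm smeas_of_Wl.
rewrite /Fprod smeas_of_prod !eta_tv.
apply: seminorm_prod_sub_le => //.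
- exact: tvD.
- exact: tvM.
- exact: tvZ.
- exact: tv1.
- exact: tv_ge0.
- exact: tv_scharge.
- rewrite -eta_tv mulrC -ltr_pdivlMr ?mul1r//.
  by rewrite !mulr_gt0 ?expR_gt0 ?c1_gt0.
Qed.

Lemma smeas_of_Fmean : (0 < n)%N -> \sum_j f j = n%:R *: smeas_of (Fmean F).
Proof.
move=> n0; rewrite /Fmean smeas_of_cscale smeas_of_sum scalerA divff ?scale1r//.
by rewrite pnatr_eq0 -lt0n.
Qed.

Lemma Fmean_setT : (0 < n)%N -> Fmean F setT = 1%E.
Proof.
move=> n0; rewrite /Fmean /= /cscale.
have -> : (\big[@saddm d T R/szero T R]_(j < n) scharge (F j)) setT =
    (\sum_(j < n) F j setT)%E.
  exact: (big_morph (fun V : charge T R => V setT)).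
under eq_bigr do rewrite probability_setT.
rewrite sumEFin sumr_const card_ord -EFinM mulVf//.
by rewrite pnatr_eq0 -lt0n.
Qed.

Lemma sum_Mjk k : (0 < n)%N -> \sum_j (f j - g) * g ^+ k =
  n%:R *: ((smeas_of (Fmean F) - g) * g ^+ k).
Proof.
move=> n0; rewrite -mulr_suml sumrB sumr_const card_ord smeas_of_Fmean//.
by rewrite -[g *+ n](@scaler_nat R) -scalerBr -scalerAl.
Qed.

(** With [m = floor(n / k) >= 1], one has [n < (m + 1) k <= 2 m k]. *)
Lemma leq_double_divn k : (0 < k <= n)%N -> (n <= 2 * k * ((n - k) %/ k).+1)%N.
Proof.
move=> /andP[k0 kn].
have -> : (((n - k) %/ k).+1 = n %/ k)%N.
  by rewrite -[in RHS](subnK kn) divnDr// divnn k0 addn1.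
have := ltn_ceil n k0; rewrite mulSn => H.
have : (k <= n %/ k * k)%N by rewrite -{1}[k]mul1n leq_mul2r divn_gt0// kn orbT.
lia.
Qed.

Lemma sqrt_smoothing_le (S : R) k : 0 <= S -> (0 < k <= n)%N ->
  Num.sqrt (S / ((n - k) %/ k).+1%:R) <=
  Num.sqrt k%:R * (Num.sqrt (2 / n%:R) * Num.sqrt S).
Proof.
move=> S0 /andP[k0 kn]; have n0 : (0 < n)%N by exact: leq_trans kn.
have n0' : (0 : R) < n%:R by rewrite ltr0n.
rewrite -!sqrtrM ?ler0n// ?divr_ge0//; apply: ler_wsqrtr.
have m0 : (0 : R) < ((n - k) %/ k).+1%:R by rewrite ltr0n.
rewrite ler_pdivrMr// (_ : _ * _%:R = S * (2 * k%:R * ((n - k) %/ k).+1%:R / n%:R)).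
  rewrite ler_peMr// ler_pdivlMr// mul1r -!natrM ler_nat.
  by apply: leq_double_divn; rewrite k0.
by field; rewrite lt0r_neq0.
Qed.

(** Both seminorms in the k-th term of [eta] are at most [k^(1/2)] times the
    corresponding bracket of the bound, so that the factor [1 / k] cancels. *)
Lemma eta_le_smoothing l (a0 S0 : R) (a S : 'I_n -> R) : (0 < n)%N ->
  0 <= a0 -> 0 <= S0 -> (forall j, 0 <= a j) -> (forall j, 0 <= S j) ->
  (forall q, tv ((smeas_of (Fmean F) - g) * g ^+ q) <=
    a0 + Num.sqrt (S0 / q.+1%:R)) ->
  (forall j q, tv ((f j - g) * g ^+ q) <= a j + Num.sqrt (S j / q.+1%:R)) ->
  eta F G l 0 <=
  (4 * c1 R)^-1 * (n%:R / Num.sqrt l.+1%:R * a0 +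
                   Num.sqrt (2 * n%:R) * Num.sqrt S0) ^+ 2 +
  \sum_j ((Num.sqrt l.+1%:R)^-1 * a j + Num.sqrt (2 / n%:R) * Num.sqrt (S j)) ^+ 2.
Proof.
move=> n0 a00 S00 aj Sj H0 Hj; set b0 := n%:R / _ * a0 + _.
set b := fun j => (Num.sqrt l.+1%:R)^-1 * a j + Num.sqrt (2 / n%:R) * Num.sqrt (S j).
have n0' : (0 : R) < n%:R by rewrite ltr0n.
have l0 : (0 : R) < Num.sqrt l.+1%:R by rewrite sqrtr_gt0 ltr0n.
have c0 := c1_gt0 R.
rewrite /eta big_nat_cond; apply: bigmax_le.
  apply: addr_ge0; last by apply: sumr_ge0 => j _; exact: sqr_ge0.
  by rewrite mulr_ge0 ?sqr_ge0// invr_ge0 mulr_ge0 ?c1_ge0.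
move=> k /andP[/andP[lk]]; rewrite ltnS => kn _.
have k0 : (0 < k)%N by exact: leq_ltn_trans lk.
have kkn : (0 < k <= n)%N by rewrite k0.
have k0' : (0 : R) < k%:R by rewrite ltr0n.
rewrite addr0 powRr1//.
have step (x y : R) : 0 <= x -> 0 <= y ->
    x + Num.sqrt (y / ((n - k) %/ k).+1%:R) <=
    Num.sqrt k%:R * ((Num.sqrt l.+1%:R)^-1 * x + Num.sqrt (2 / n%:R) * Num.sqrt y).
  move=> x0 y0; rewrite mulrDr lerD ?sqrt_smoothing_le// mulrA ler_peMl//.
  by rewrite ler_pdivlMr// mul1r ler_wsqrtr// ler_nat.
have nuj j : tv ((f j - g) * g ^+ ((n - k) %/ k)) <= Num.sqrt k%:R * b j.
  by apply: le_trans (Hj j _) _; exact: step.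
have nu0 : nu_tilde F G k <= Num.sqrt k%:R * b0.
  rewrite nu_tilde_tv sum_Mjk// tvZ ger0_norm//.
  apply: le_trans (ler_wpM2l (ltW n0') (le_trans (H0 _) (step _ _ a00 S00))) _.
  rewrite mulrCA ler_wpM2l ?sqrtr_ge0// mulrDr !mulrA lerD2l ler_wpM2r ?sqrtr_ge0//.
  rewrite -{1}(ger0_norm (ltW n0')) -sqrtr_sqr -sqrtrM ?sqr_ge0//.
  by rewrite ler_wsqrtr// le_eqVlt (_ : _ * _ = 2 * n%:R) ?eqxx//; field; rewrite lt0r_neq0.
have sq (x y : R) : 0 <= x -> x <= Num.sqrt k%:R * y -> x ^+ 2 <= k%:R * y ^+ 2.
  move=> x0 xy; rewrite -{1}(sqr_sqrtr (ltW k0')) -exprMn lerXn2r ?nnegrE//.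
  exact: le_trans xy.
rewrite ler_pdivrMl// mulrDr lerD//.
  rewrite mulrCA mulrC ler_wpM2l ?invr_ge0 ?mulr_ge0 ?c1_ge0//.
  by apply: sq nu0; exact: tvnorm_ge0.
rewrite nu_tv mulr_sumr ler_sum// => j _; apply: sq; [exact: tv_ge0|exact: nuj].
Qed.
End approximation_in_algebra.

(** * The bound on eta in terms of densities *)

Lemma sqr_add_sqrte_pinfty (R : realType) (c : R) (x : \bar R) :
  0 < c -> (0 <= x -> (x + c%:E * sqrte +oo) ^+ 2 = +oo)%E.
Proof.
move=> c0 x0; rewrite [sqrte _]/= gt0_muley ?lte_fin// addey; last by rewrite gt_eqF// (lt_le_trans _ x0).
by rewrite expe2 mulyy.
Qed.

Section square_integrable_density.
Context d (T : measurableZmodType d) (R : realType) (G : probability T R).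

Lemma is_density_sqr_integrable (V : charge T R) (D : set T) f :
  measurable D -> is_density V G f ->
  (\int[G]_(x in D) ((f x - 1) ^+ 2)%:E != +oo)%E ->
  G.-integrable D (EFin \o (fun x => (f x - 1) ^+ 2)).
Proof.
move=> mD [fi _] fin; apply/integrableP; split.
  apply/measurable_EFinP/measurable_funX/measurable_funB; last exact: measurable_cst.
  by apply/measurable_EFinP; apply: measurable_funTS; exact: measurable_int fi.
under eq_integral => x _ do rewrite gee0_abs ?lee_fin ?sqr_ge0//.
by rewrite ltey.
Qed.
End square_integrable_density.

Lemma eta_le_density (R : realType) (d : measure_display)
    (T : measurableZmodType d) (n : nat) (n_gt0 : (0 < n)%N)
    (F : 'I_n -> probability T R) (G : probability T R)
    (B0 : set T) (mB0 : measurable B0)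
    (B : 'I_n -> set T) (mB : forall j, measurable (B j))
    (f0 : T -> R) (f : 'I_n -> T -> R) (l : nat) :
  is_density (crestr (Fmean F) (measurableC mB0)) G f0 ->
  (forall j, is_density (crestr (scharge (F j)) (measurableC (mB j))) G (f j)) ->
  ((eta F G l 0)%:E <=
   ((4 * c1 R)^-1)%:E *
   ((n%:R / Num.sqrt l.+1%:R)%:E *
      ((tvnorm (crestr (ssubm (Fmean F) (scharge G)) mB0))%:E +
       `| ssubm (Fmean F) (scharge G) B0 |) +
    (Num.sqrt (2 * n%:R))%:E *
      sqrte (\int[G]_(x in ~` B0) ((f0 x - 1) ^+ 2)%:E)) ^+ 2 +
   \sum_(j < n)
    ((Num.sqrt l.+1%:R)^-1%:E *
       ((tvnorm (crestr (Fdiff F G j) (mB j)))%:E +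
        `| Fdiff F G j (B j) |) +
     (Num.sqrt (2 / n%:R))%:E *
       sqrte (\int[G]_(x in ~` B j) ((f j x - 1) ^+ 2)%:E)) ^+ 2)%E.
Proof.
move=> df0 df.
have l0 : (0 : R) < Num.sqrt l.+1%:R by rewrite sqrtr_gt0 ltr0n.
have n0 : (0 : R) < n%:R by rewrite ltr0n.
have c0 := c1_gt0 R.
set X0 := (\int[G]_(x in ~` B0) _)%E.
set X := fun j => (\int[G]_(x in ~` B j) ((f j x - 1) ^+ 2)%:E)%E.
have X0_ge0 : (0 <= X0)%E by apply: integral_ge0 => x _; rewrite lee_fin sqr_ge0.
have X_ge0 j : (0 <= X j)%E by apply: integral_ge0 => x _; rewrite lee_fin sqr_ge0.
set A0 := (_ + `| ssubm _ _ _ |)%E.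
set A := fun j => ((tvnorm (crestr (Fdiff F G j) (mB j)))%:E + `| Fdiff F G j (B j) |)%E.
pose term j := (((Num.sqrt l.+1%:R)^-1%:E * A j +
  (Num.sqrt (2 / n%:R))%:E * sqrte (X j)) ^+ 2)%E.
rewrite -[X in (_ <= _ + X)%E]/(\sum_(j < n) term j)%E.
have A0_ge0 : (0 <= A0)%E by rewrite adde_ge0 ?lee_fin ?tvnorm_ge0.
have A_ge0 j : (0 <= A j)%E by rewrite adde_ge0 ?lee_fin ?tvnorm_ge0.
have sq_ge0 (x : \bar R) : (0 <= x -> 0 <= x ^+ 2)%E.
  by move=> x0; rewrite expe2 mule_ge0.
have neNy (x : \bar R) : (0 <= x)%E -> x != -oo%E by case: x.
have term0_ge0 : (0 <= ((4 * c1 R)^-1)%:E * ((n%:R / Num.sqrt l.+1%:R)%:E * A0 +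
    (Num.sqrt (2 * n%:R))%:E * sqrte X0) ^+ 2)%E.
  rewrite mule_ge0//; first by rewrite lee_fin invr_ge0 mulr_ge0 ?c1_ge0.
  by apply: sq_ge0; rewrite adde_ge0 ?mule_ge0 ?sqrte_ge0// lee_fin ?divr_ge0 ?sqrtr_ge0.
have term_ge0 j : (0 <= term j)%E.
  by apply: sq_ge0; rewrite adde_ge0 ?mule_ge0 ?sqrte_ge0// lee_fin ?invr_ge0 ?sqrtr_ge0.
have [X0y|X0fin] := eqVneq X0 +oo%E.
  rewrite X0y sqr_add_sqrte_pinfty ?sqrtr_gt0 ?mulr_gt0//; last first.
    by rewrite mule_ge0// lee_fin divr_ge0 ?ltW.
  rewrite gt0_muley ?lte_fin ?invr_gt0 ?mulr_gt0// addye ?leey//.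
  by apply: neNy; apply: sume_ge0 => j _; exact: term_ge0.
have [/existsP[j /eqP Xjy]|/existsPn Xfin] := boolP [exists j, X j == +oo%E].
  have termy : term j = +oo%E.
    rewrite /term Xjy sqr_add_sqrte_pinfty ?sqrtr_gt0 ?divr_gt0//.
    by rewrite mule_ge0// lee_fin invr_ge0 sqrtr_ge0.
  rewrite (bigD1 j)//= termy.
  rewrite addye; last by apply: neNy; exact: sume_ge0.
  by rewrite addey ?leey//; exact: neNy.
have fX0 : X0 \is a fin_num by rewrite ge0_fin_numE// ltey.
have fX j : X j \is a fin_num by rewrite ge0_fin_numE// ltey Xfin.
pose a0 := tvnorm (crestr (ssubm (Fmean F) (scharge G)) mB0) +
  `|fine (ssubm (Fmean F) (scharge G) B0)|.
pose a j := tvnorm (crestr (Fdiff F G j) (mB j)) + `|fine (Fdiff F G j (B j))|.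
have A0E : A0 = a0%:E.
  by rewrite /A0 /a0 EFinD -abse_EFin; congr (_ + `|_|)%E;
    rewrite fineK// fin_num_measure.
have AE j : A j = (a j)%:E.
  by rewrite /A /a EFinD -abse_EFin; congr (_ + `|_|)%E;
    rewrite fineK// fin_num_measure.
have termE j : term j = (((Num.sqrt l.+1%:R)^-1 * a j +
    Num.sqrt (2 / n%:R) * Num.sqrt (fine (X j))) ^+ 2)%:E.
  by rewrite /term AE -(fineK (fX j)) EFin_expe.
rewrite (eq_bigr _ (fun j _ => termE j)) sumEFin.
rewrite [X in (_ <= X + _)%E](_ : _ = ((4 * c1 R)^-1 *
    (n%:R / Num.sqrt l.+1%:R * a0 + Num.sqrt (2 * n%:R) * Num.sqrt (fine X0)) ^+ 2)%:E).
  rewrite -EFinD lee_fin.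
  apply: eta_le_smoothing => //.
  - by rewrite addr_ge0 ?tvnorm_ge0.
  - by rewrite fine_ge0.
  - by move=> j; rewrite addr_ge0 ?tvnorm_ge0.
  - by move=> j; rewrite fine_ge0.
  - move=> q; apply: tv_smoothing_le; [exact: Fmean_setT|exact: df0|].
    exact: is_density_sqr_integrable (measurableC mB0) df0 X0fin.
  - move=> j q; apply: tv_smoothing_le; [exact: probability_setT|exact: df|].
    exact: is_density_sqr_integrable (measurableC (mB j)) (df j) (Xfin j).
by rewrite A0E -(fineK fX0).
Qed.

(** * The theorem *)

Theorem theorem2p1 (R : realType) (d : measure_display)
    (T : measurableZmodType d) (n : nat) (n_gt0 : (0 < n)%N)
    (F : 'I_n -> probability T R) (G : probability T R) :
  [/\ (* c1 = 0.694025... (truncated decimal expansion) *)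
      694 / 10 ^+ 3 + 25 / 10 ^+ 6 <= c1 R < 694 / 10 ^+ 3 + 26 / 10 ^+ 6,
      (* (a) *)
      forall (alpha : R) (l : nat), 0 <= alpha -> (l <= n)%N ->
        let beta := `|Num.ceil (alpha * l.+1%:R / 2)|%N in
        eta F G l 0 < (2 * expR 1 * c1 R)^-1 ->
        tvnorm (ssubm (Fprod F) (Wl F G l)) <=
          l.+1%:R ^+ beta * beta`!%:R *
          ((2 * expR 1 * c1 R * eta F G l alpha) `^ (l.+1%:R / 2) /
           (1 - Num.sqrt (2 * expR 1 * c1 R * eta F G l 0)) ^+ beta.+1),
      (* (a), in particular *)
      forall l : nat, (l <= n)%N ->
        eta F G l 0 < (2 * expR 1 * c1 R)^-1 ->
        tvnorm (ssubm (Fprod F) (Wl F G l)) <=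
          (2 * expR 1 * c1 R * eta F G l 0) `^ (l.+1%:R / 2) /
          (1 - Num.sqrt (2 * expR 1 * c1 R * eta F G l 0)) &
      (* (b) *)
      forall (B0 : set T) (mB0 : measurable B0)
        (B : 'I_n -> set T) (mB : forall j, measurable (B j))
        (f0 : T -> R) (f : 'I_n -> T -> R),
        crestr (Fmean F) (measurableC mB0) `<< G ->
        (forall j, crestr (scharge (F j)) (measurableC (mB j)) `<< G) ->
        is_density (crestr (Fmean F) (measurableC mB0)) G f0 ->
        (forall j,
          is_density (crestr (scharge (F j)) (measurableC (mB j))) G (f j)) ->
        forall l : nat, (l <= n)%N ->
        ((eta F G l 0)%:E <=
         ((4 * c1 R)^-1)%:E *
         ((n%:R / Num.sqrt l.+1%:R)%:E *
            ((tvnorm (crestr (ssubm (Fmean F) (scharge G)) mB0))%:E +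
             `| ssubm (Fmean F) (scharge G) B0 |) +
          (Num.sqrt (2 * n%:R))%:E *
            sqrte (\int[G]_(x in ~` B0) ((f0 x - 1) ^+ 2)%:E)) ^+ 2 +
         \sum_(j < n)
          ((Num.sqrt l.+1%:R)^-1%:E *
             ((tvnorm (crestr (Fdiff F G j) (mB j)))%:E +
              `| Fdiff F G j (B j) |) +
           (Num.sqrt (2 / n%:R))%:E *
             sqrte (\int[G]_(x in ~` B j) ((f j x - 1) ^+ 2)%:E)) ^+ 2)%E].
Proof.
split.
- by apply/andP; split; [exact: c1_ge|exact: c1_lt].
- by move=> alpha l alpha0 ln beta eta_lt; exact: tvnorm_prod_sub_le.
- move=> l ln eta_lt; have := tvnorm_prod_sub_le (lexx 0) ln eta_lt.
  by rewrite /= !mul0r ceil0 absz0 expr0 fact0 !mul1r expr1.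
- by move=> B0 mB0 B mB f0 f _ _ df0 df l _; exact: eta_le_density.
Qed.
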